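(* For any connected, compact Lie group $G$, the average signature $\mathbb A(G)=\sum_{k\ge0}A_k$ consists of only even degree terms, that is, $A_k=0$ whenever $k$ is odd.
   Context: Let $G$ be a connected compact Lie group of dimension $n$ with identity $e$ and Lie algebra $\mathfrak g\cong T_eG$, endowed with a bi-invariant Riemannian metric, and let $\mu$ be a Haar measure on $G$. Signature: fix a basis $\{e_1,\dots,e_n\}$ of $\mathfrak g$, extend it to a left-invariant frame on $G$, and let $\{\omega_1,\dots,\omega_n\}$ be the dual left-invariant 1-forms. For a continuous piecewise $C^1$ path $\gamma:[0,1]\to G$ put $S_0(\gamma)=1$ and, for $k\ge1$, $$S_k(\gamma)=\sum_{1\le i_1,\dots,i_k\le n}\left(\int_{0<u_1<\cdots<u_k<1}\omega_{i_1}(\gamma'(u_1))\cdots\omega_{i_k}(\gamma'(u_k))\,du_1\cdots du_k\right)e_{i_1}\otimes\cdots\otimes e_{i_k}\in\mathfrak g^{\otimes k}$$ (this does not depend on the choice of basis). Average signature: for every $g\in G$ outside the cut locus of $e$ (a $\mu$-null set), let $\gamma_g:[0,1]\to G$ be the unique constant speed length-minimizing geodesic from $e$ to $g$. Then $\mathbb A(G)=\sum_{k\ge0}A_k$ (formal series) with $A_k=\frac1{\mu(G)}\int_G S_k(\gamma_g)\,d\mu(g)\in\mathfrak g^{\otimes k}$. It does not depend on the choice of Haar measure or of bi-invariant metric. *)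

(* Defs.v *)
From HB Require Import structures.
From mathcomp Require Import all_boot all_order all_algebra.
From mathcomp Require Import all_classical all_reals all_analysis.
Import Order.TTheory GRing.Theory Num.Theory.
Import numFieldNormedType.Exports.

Set Implicit Arguments.
Unset Strict Implicit.
Unset Printing Implicit Defensive.

Local Open Scope classical_set_scope.
Local Open Scope ring_scope.

Section Smooth.
Context {R : realType} {m : nat} {W : normedModType R}.

Definition partial (i : 'I_m) (f : 'rV[R]_m -> W) : 'rV[R]_m -> W :=
  fun x => 'D_(delta_mx 0 i) f x.

Definition smooth_on (U : set 'rV[R]_m) (f : 'rV[R]_m -> W) : Prop :=
  forall (s : seq 'I_m) x, U x -> differentiable (foldr partial f s) x.

End Smooth.

(* [chart_fun] and [chart_inv] are total functions; only their values on
   [chart_dom] and [chart_codom] are meaningful. *)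
Record chart (R : realType) (n : nat) (M : topologicalType) := Chart {
  chart_dom : set M;
  chart_fun :> M -> 'rV[R]_n;
  chart_inv : 'rV[R]_n -> M;
  open_chart_dom : open chart_dom;
  open_chart_codom : open (chart_fun @` chart_dom);
  chart_funK : {in chart_dom, cancel chart_fun chart_inv};
  chart_fun_continuous : {within chart_dom, continuous chart_fun};
  chart_inv_continuous :
    {within chart_fun @` chart_dom, continuous chart_inv} }.

Definition chart_codom {R n M} (c : @chart R n M) : set 'rV[R]_n :=
  c @` chart_dom c.

(* A smooth atlas in which one chart around each point p is singled out; the
   atlas consists of these charts.  The chart at p also serves to identify the
   tangent space T_pM with 'rV[R]_n, so that below a tangent vector at p is
   given by its components in the chart at p. *)
HB.mixin Record isManifold (R : realType) (n : nat) M of Topological M := {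
  chart_at : M -> chart R n M;
  mem_chart_at : forall p, chart_dom (chart_at p) p;
  chart_transition_smooth : forall p q,
    smooth_on
      (chart_codom (chart_at p) `&`
       chart_inv (chart_at p) @^-1` chart_dom (chart_at q))
      (chart_at q \o chart_inv (chart_at p));
  manifold_hausdorff : hausdorff_space M;
  manifold_second_countable : @second_countable M }.

#[short(type="manifoldType")]
HB.structure Definition Manifold (R : realType) (n : nat) :=
  {M of Topological M & isManifold R n M}.

Section TangentMaps.
Context {R : realType} {n : nat}.

(* The differential T_pM -> T_(f p)N. *)
Definition tangent_map {M N : manifoldType R n} (f : M -> N) (p : M)
    (v : 'rV[R]_n) : 'rV[R]_n :=
  'D_v (chart_at (f p) \o f \o chart_inv (chart_at p)) (chart_at p p).

(* The velocity of c at time t, an element of T_(c t)M. *)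
Definition velocity {M : manifoldType R n} (c : R -> M) (t : R) : 'rV[R]_n :=
  derive1 (chart_at (c t) \o c) t.

End TangentMaps.

Section Curves.
Context {R : realType} {n : nat} {M : manifoldType R n}.

Definition C1_on (I : set R) (c : R -> M) : Prop :=
  forall t, I t -> {for t, continuous c} /\
    forall p, chart_dom (chart_at p) (c t) ->
      derivable (chart_at p \o c) t 1 /\
      {for t, continuous (derive1 (chart_at p \o c))}.

(* Paths [0, 1] -> M are functions R -> M whose values outside [0, 1] are
   irrelevant.  A path is C1 on a compact interval if it coincides there with
   a path that is C1 on an open neighbourhood of that interval. *)
Definition piecewise_C1 (c : R -> M) : Prop :=
  {within `[0, 1], continuous c} /\
  exists2 s : seq R, itv_partition 0 1 s &
    forall i, (i < size s)%N ->
      exists (d : R) (c' : R -> M),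
        [/\ 0 < d,
            C1_on `](0 :: s)`_i - d, s`_i + d[ c' &
            {in `[(0 :: s)`_i, s`_i], c' =1 c}].

End Curves.

Section GramMatrices.
Context {R : realType} {n : nat} {M : manifoldType R n}.

(* The matrix, in the chart at q, of a family of bilinear forms on the tangent
   spaces of M: its (i, j) entry at x is the value on the i-th and j-th
   coordinate vectors of the chart at q. *)
Definition local_gram (gram : M -> 'M[R]_n) (q : M) (x : 'rV[R]_n) : 'M[R]_n :=
  let p := chart_inv (chart_at q) x in
  let J := \matrix_(i < n)
    'D_(delta_mx 0 i) (chart_at p \o chart_inv (chart_at q)) x in
  J *m gram p *m J^T.

End GramMatrices.

Record riemannian_metric (R : realType) (n : nat) (M : manifoldType R n) :=
  RiemannianMetric {
    gram : M -> 'M[R]_n;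
    gram_sym : forall p, (gram p)^T = gram p;
    gram_posdef : forall p (v : 'rV[R]_n),
      v != 0 -> 0 < (v *m gram p *m v^T) 0 0;
    gram_smooth : forall q,
      smooth_on (chart_codom (chart_at q)) (local_gram gram q) }.

Section Riemannian.
Context {R : realType} {n : nat} {M : manifoldType R n}.
Variable g : riemannian_metric M.

Definition inner (p : M) (u v : 'rV[R]_n) : R := (u *m gram g p *m v^T) 0 0.

Definition isometric (f : M -> M) : Prop :=
  forall p u v, inner (f p) (tangent_map f p u) (tangent_map f p v) = inner p u v.

Definition speed (c : R -> M) (t : R) : R :=
  Num.sqrt (inner (c t) (velocity c t) (velocity c t)).

Definition path_length (c : R -> M) : R :=
  \int[lebesgue_measure]_(t in `[0, 1]) speed c t.

Definition path_between (p q : M) (c : R -> M) : Prop :=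
  [/\ piecewise_C1 c, c 0 = p & c 1 = q].

Definition dist (p q : M) : R := inf (path_length @` path_between p q).

(* Christoffel symbols of the Levi-Civita connection in the chart at q; the
   upper index is k. *)
Definition christoffel (q : M) (x : 'rV[R]_n) (i j k : 'I_n) : R :=
  let h a b := fun y => local_gram (gram g) q y a b in
  2^-1 * \sum_l invmx (local_gram (gram g) q x) k l *
    (partial i (h j l) x + partial j (h i l) x - partial l (h i j) x).

Definition geodesic_on (I : set R) (c : R -> M) : Prop :=
  forall t, I t -> {for t, continuous c} /\
    forall q, chart_dom (chart_at q) (c t) ->
      let x := chart_at q \o c in
      let x' := derive1 x in
      [/\ derivable x t 1, derivable x' t 1 &
          forall k, derive1 x' t 0 k +
            \sum_i \sum_j christoffel q (x t) i j k *
                          x' t 0 i * x' t 0 j = 0].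

Definition minimizing_geodesic (p q : M) (c : R -> M) : Prop :=
  [/\ exists2 d : R, 0 < d & geodesic_on `]- d, 1 + d[ c,
      exists v : R, forall t, t \in `[0, 1] -> speed c t = v,
      path_between p q c &
      forall c', path_between p q c' -> path_length c <= path_length c'].

Definition unique_minimizing_geodesic (p q : M) (c : R -> M) : Prop :=
  minimizing_geodesic p q c /\
  forall c', minimizing_geodesic p q c' -> {in `[0, 1], c' =1 c}.

(* "The" unique minimizing geodesic from p to q; where there is none, or more
   than one, this is the constant path at p. *)
Definition the_minimizing_geodesic (p q : M) : R -> M :=
  xget (fun=> p) (unique_minimizing_geodesic p q).

(* The points c t0 where a unit speed geodesic c issuing from p ceases to be
   minimizing. *)
Definition cut_locus (p : M) : set M :=
  [set q | exists (c : R -> M) (t0 : R),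
    [/\ geodesic_on setT c, forall t, speed c t = 1, c 0 = p, 0 < t0 &
        (forall t, 0 <= t -> (dist p (c t) = t <-> t <= t0)) /\ c t0 = q]].

End Riemannian.

HB.mixin Record isLieGroup (R : realType) (n : nat) G
    of Group G & Manifold R n G := {
  lie_mul_continuous : continuous (fun z : G * G => (z.1 * z.2)%g);
  lie_inv_continuous : continuous (fun x : G => x^-1%g);
  lie_mul_smooth : forall p q r : G,
    let f (z : 'rV[R]_(n + n)) : G :=
      (chart_inv (chart_at p) (lsubmx z) * chart_inv (chart_at q) (rsubmx z))%g in
    smooth_on
      [set z | [/\ chart_codom (chart_at p) (lsubmx z),
                   chart_codom (chart_at q) (rsubmx z) &
                   chart_dom (chart_at r) (f z)]]
      (chart_at r \o f);
  lie_inv_smooth : forall p r : G,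
    let f (x : 'rV[R]_n) : G := (chart_inv (chart_at p) x)^-1%g in
    smooth_on (chart_codom (chart_at p) `&` f @^-1` chart_dom (chart_at r))
      (chart_at r \o f) }.

#[short(type="lieGroupType")]
HB.structure Definition LieGroup (R : realType) (n : nat) :=
  {G of Group G & Manifold R n G & isLieGroup R n G}.

Definition bi_invariant {R n} {G : lieGroupType R n} (g : riemannian_metric G) :=
  forall a : G, isometric g (fun x => (a * x)%g) /\ isometric g (fun x => (x * a)%g).

(* G with its Borel sigma-algebra; measurable types are required to be pointed,
   and the point is taken to be the unit. *)
Definition pointed_group {R n} (G : lieGroupType R n) : Type := G.

HB.instance Definition _ R n (G : lieGroupType R n) :=
  Topological.on (pointed_group G).
HB.instance Definition _ R n (G : lieGroupType R n) :=
  isPointed.Build (pointed_group G) (1%g : G).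

Notation borel G := (g_sigma_algebraType (@open (pointed_group G))).

Definition haar_measure {R n} {G : lieGroupType R n}
    (mu : {measure set (borel G) -> \bar R}) : Prop :=
  [/\ (forall (a : G) (A : set (borel G)), measurable A ->
        mu [set (a * x)%g | x in A] = mu A),
      mu setT != 0%E,
      (forall K : set G, compact K -> (mu K < +oo)%E),
      (forall A : set (borel G), measurable A ->
        mu A = ereal_inf [set mu U | U in [set U : set G | open U /\ A `<=` U]]) &
      (forall U : set G, open U ->
        mu U = ereal_sup [set mu K | K in [set K : set G | compact K /\ K `<=` U]])].

(* The k-th tensor power of 'rV[R]_n: the tensor t is given by its components
   t J in the basis of the tensors e_(J 1) (x) ... (x) e_(J k) built from the
   standard basis. *)
Definition tensor_power (R : realType) (n k : nat) :=
  {ffun k.-tuple 'I_n -> R^o}.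

Definition pure_tensor {R : realType} {n k : nat} (w : 'I_k -> 'rV[R]_n) :
    tensor_power R n k :=
  [ffun J : k.-tuple 'I_n => \prod_(l < k) w l 0 (tnth J l)].

(* For f = [:: f_1; ...; f_k], the integral of f_1(u_1) ... f_k(u_k) over
   a < u_1 < ... < u_k < 1. *)
Fixpoint simplex_integral {R : realType} (a : R) (f : seq (R -> R)) : R :=
  if f is f1 :: f' then
    \int[lebesgue_measure]_(u in `]a, 1[) (f1 u * simplex_integral u f')
  else 1.

Section Signature.
Context {R : realType} {n : nat} {G : lieGroupType R n}.

(* The Lie algebra is T_eG = 'rV[R]_n; a basis e_1, ..., e_n is given by the
   rows of an invertible matrix B.  Row i of [left_frame B x] is the value at x
   of the left-invariant vector field extending e_i. *)
Definition left_frame (B : 'M[R]_n) (x : G) : 'M[R]_n :=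
  \matrix_(i < n) tangent_map (fun y : G => (x * y)%g) 1%g (row i B).

Definition dual_form (B : 'M[R]_n) (i : 'I_n) (x : G) (v : 'rV[R]_n) : R :=
  (v *m invmx (left_frame B x)) 0 i.

Definition signature (B : 'M[R]_n) (k : nat) (c : R -> G) : tensor_power R n k :=
  \sum_(I : k.-tuple 'I_n)
    simplex_integral 0
      [seq (fun u => dual_form B i (c u) (velocity c u)) | i <- I] *:
    pure_tensor (fun l => row (tnth I l) B).

(* The degree k term of the average signature; the integral of a tensor valued
   function is taken componentwise. *)
Definition average_signature (g : riemannian_metric G)
    (mu : {measure set (borel G) -> \bar R}) (B : 'M[R]_n) (k : nat) :
    tensor_power R n k :=
  (fine (mu setT))^-1 *:
  [ffun J : k.-tuple 'I_n =>
    \int[mu]_(x in ~` cut_locus g (1%g : G))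
      signature B k (the_minimizing_geodesic g (1%g : G) x) J : R^o].

End Signature.

(* Main.v *)
From HB Require Import structures.
Require Import Defs.
From mathcomp Require Import all_boot all_order all_algebra.
From mathcomp Require Import all_classical all_reals all_analysis.
From mathcomp Require Import ring lra measurable_realfun.
Import Order.TTheory GRing.Theory Num.Theory.
Import numFieldNormedType.Exports.

(** Inversion kills the odd part of the average signature.  Let [i x = x^-1].  It
preserves the cut locus of the identity and any Haar measure, and it carries the
minimizing geodesic from 1 to [x] to the minimizing geodesic from 1 to [x^-1].
Along a geodesic of a bi-invariant metric the velocity, read in a left-invariant
frame, is a constant vector [X], and along the inverted geodesic it is [- X]; so
the degree [k] signature is multiplied by [(-1) ^ k].  For odd [k] the integrand
is therefore odd under a measure preserving involution, and its integral is 0.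

Geodesics.  The geodesic equation is given by Christoffel symbols in charts.  The
bridge to the group structure is Noether's theorem ([noether]): if [K] is a
Killing field, then the derivative of [<c', K>] along any C^2 curve [c] is
[<D_t c', K>], with [D_t c'] the covariant acceleration.  Right translations are
isometries generated by the left-invariant fields and left translations are
isometries generated by the right-invariant fields, so for a bi-invariant metric
both kinds of fields are Killing.  That the field generated by a smooth family of
isometries is Killing is the derivative of the isometry identity in the
parameter, and uses the symmetry of second derivatives
([killing_of_isometries]).  As invariant fields span every tangent space, a C^2
curve is a geodesic if and only if its charges with respect to the left-invariant
fields are conserved, and likewise for the right-invariant fields ([geodesicP]).
The left charges of [i o c] are the opposite of the right charges of [c]
([chargeL_inv]).  Hence [i] maps geodesics to geodesics ([inv_geodesic]), and for
a geodesic starting at 1, where left and right charges agree, the left charges of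
[i o c] and of [c] are opposite at all times ([chargeL_inv_geodesic]).

Integrals.  The measurability of the signature as a function of the end point is a
delicate matter, which the proof avoids.  The integral is defined for every
function, as a difference of two suprema of integrals of simple functions, and on
arbitrary functions it still commutes with the opposite, ignores null sets and is
invariant under measure preserving involutions ([RintegralN_nonmeasurable],
[integral_off_null], [Rintegral_involution]).

Haar measure.  Computing the measure of [{(x, y) | x^-1 y \in A}] in the product of
the Haar measure with itself in both orders gives
[mu A * mu G = mu A^-1 * mu G] ([haar_inv]); compactness makes [mu G] finite. *)

Set Implicit Arguments.
Unset Strict Implicit.
Unset Printing Implicit Defensive.

Local Open Scope classical_set_scope.
Local Open Scope ring_scope.

(** * Symmetry of second derivatives and the chain rule *)

Section Calculus.
Context {R : realType}.

Lemma diff_littleo (V : normedModType R) (f : V -> R) (z : V) (e : R) :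
  differentiable f z -> 0 < e ->
  \forall k \near 0, `|f (z + k) - f z - 'd f z k| <= e * `|k|.
Proof.
move=> df e0; have := diff_locallyxC df => H.
have : (fun h => f (z + h)) = (fun h => f z + 'd f z h) +o_ (0:V) id.
  by rewrite funeqE => h; exact: H.
move/eqaddoP => /(_ e e0); apply: filterS => k /=.
by rewrite !fctE /= opprD addrA.
Qed.

(** The chain rule along a curve, for a function of a vector variable. *)
Lemma is_derive_curve (V W : normedModType R) (f : V -> W) (x : R -> V) (t : R) :
  differentiable f (x t) -> derivable x t 1 ->
  is_derive t 1 (f \o x) ('D_(x^`()%classic t) f (x t)).
Proof.
move=> df /derivable1_diffP dx.
have dc : differentiable (f \o x) t by exact: differentiable_comp.
apply: DeriveDef; first exact: diff_derivable.
by rewrite deriveE// diff_comp//= deriveE // derive1E'.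
Qed.

Lemma is_derive_line (V : normedModType R) (f : V -> R) (z v : V) (s : R) :
  differentiable f (z + s *: v) ->
  is_derive s 1 (fun s => f (z + s *: v)) ('D_v f (z + s *: v)).
Proof.
move=> df.
have dl := is_diffD (is_diff_cst z s) (is_diff_scalel s v).
have dl' : differentiable (fun s : R => z + s *: v) s := @ex_diff _ _ _ _ _ _ _ dl.
have dv : (fun s : R => z + s *: v)^`()%classic s = v.
  by rewrite derive1E' // (@diff_val _ _ _ _ _ _ _ dl) fctE scale1r add0r.
have := @is_derive_curve _ _ f (fun s : R => z + s *: v) s df.
by rewrite dv; apply; exact/derivable1_diffP.
Qed.

(** Its symmetry in [u] and [v] is what forces the two mixed derivatives to agree. *)
Definition second_difference (V : normedModType R) (f : V -> R) (z u v : V) : R :=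
  f (z + u + v) - f (z + u) - f (z + v) + f z.

Lemma second_differenceC (V : normedModType R) (f : V -> R) z u v :
  second_difference f z u v = second_difference f z v u.
Proof.
rewrite /second_difference (addrAC z v u); congr (_ + _).
exact: addrAC.
Qed.

(** The mean value theorem applied to [s |-> f (z + h v + s u) - f (z + s u)] turns the
    second difference into [h] times a difference of values of ['D_u f], which the
    differentiability of ['D_u f] at [z] estimates up to [o (h ^ 2)]. *)
Lemma second_difference_derive (V : normedModType R) (f : V -> R) (z u v : V) (e : R) :
  (\forall y \near z, differentiable f y) ->
  differentiable ('D_u f) z -> 0 < e ->
  \forall h \near (0:R)^'+,
    `|second_difference f z (h *: u) (h *: v) - h ^+ 2 * 'D_v ('D_u f) z| <= e * h ^+ 2.
Proof.
move=> df ddf e0.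
(* [h * c] bounds the norms of all the displacements that occur; adding 1 makes [c]
   positive. *)
set c := 2 * `|u| + `|v| + 1.
have c0 : 0 < c by rewrite ltr_wpDl // addr_ge0 // mulr_ge0.
have e0' : 0 < e / c by rewrite divr_gt0.
have /nbhs_ballP[r1 /= r10 Hr1] := diff_littleo ddf e0'.
have /nbhs_ballP[r2 /= r20 Hr2] := df.
near=> h.
have h0 : 0 < h by near: h; exact: nbhs_right_gt.
have hr1 : h * c < r1.
  by rewrite -ltr_pdivlMr //; near: h; apply: nbhs_right_lt; rewrite divr_gt0.
have hr2 : h * c < r2.
  by rewrite -ltr_pdivlMr //; near: h; apply: nbhs_right_lt; rewrite divr_gt0.
pose phi s := f (z + h *: v + s *: u) - f (z + s *: u).
have small (t b r : R) : 0 <= t <= h -> 0 <= b <= h -> h * c < r ->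
    `|b *: v + t *: u| < r.
  move=> /andP[t0 th] /andP[b0 bh]; apply: le_lt_trans.
  rewrite (le_trans (ler_normD _ _))// !normrZ !ger0_norm //.
  rewrite /c; have := normr_ge0 u; have := normr_ge0 v => ? ?; nra.
have nz (t b : R) : 0 <= t <= h -> 0 <= b <= h ->
    differentiable f (z + b *: v + t *: u).
  move=> t0 b0; apply: Hr2; rewrite -ball_normE /= -addrA opprD addrA subrr sub0r normrN.
  exact: small.
have dphi s : s \in `[0, h] ->
    is_derive s 1 phi ('D_u f (z + h *: v + s *: u) - 'D_u f (z + s *: u)).
  rewrite in_itv /= => sh; apply: is_deriveB.
    by apply: is_derive_line; apply: nz => //; rewrite ltW //= lexx.
  apply: is_derive_line; have := @nz s 0 sh; rewrite scale0r addr0; apply.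
  by rewrite lexx ltW.
have cphi : {within `[0, h], continuous phi}.
  by apply: derivable_within_continuous => s sh; have := dphi s sh; case.
have dphi' s : s \in `]0, h[ ->
    is_derive s 1 phi ('D_u f (z + h *: v + s *: u) - 'D_u f (z + s *: u)).
  by move=> sh; apply: dphi; exact: subset_itv_oo_cc sh.
have [s sh] := MVT h0 dphi' cphi.
rewrite subr0 {1 2}/phi !scale0r !addr0 => E.
have -> : second_difference f z (h *: u) (h *: v) =
    ('D_u f (z + h *: v + s *: u) - 'D_u f (z + s *: u)) * h.
  rewrite -E /second_difference (addrAC z (h *: u)); ring.
have {}sh : 0 <= s <= h by move: sh; rewrite in_itv /= => /andP[/ltW-> /ltW->].
have hh : 0 <= h <= h by rewrite lexx ltW.
have h00 : (0:R) <= 0 <= h by rewrite lexx ltW.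
have := Hr1 (h *: v + s *: u); rewrite -ball_normE /= sub0r normrN => /(_ (small _ _ _ sh hh hr1)).
have := Hr1 (0 *: v + s *: u); rewrite -ball_normE /= sub0r normrN => /(_ (small _ _ _ sh h00 hr1)).
rewrite scale0r add0r [X in X -> _]/= addrA.
have -> : 'd ('D_u f) z (h *: v + s *: u) = h * 'D_v ('D_u f) z + 'd ('D_u f) z (s *: u).
  by rewrite linearD linearZ /= deriveE.
set A := 'D_u f (z + h *: v + s *: u); set B := 'D_u f (z + s *: u); set C := 'D_u f z.
set L := 'D_v _ _; set D := 'd _ _ _ => H1 H2.
have H3 : `|A - B - h * L| <= e / c * (`|h *: v + s *: u| + `|s *: u|).
  rewrite mulrDr; apply: le_trans (lerD H2 H1).
  apply: le_trans (ler_normB _ _).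
  rewrite le_eqVlt; apply/orP; left; apply/eqP; congr `| _ |.
  by rewrite /GRing.scale /=; ring.
have -> : (A - B) * h - h ^+ 2 * L = h * (A - B - h * L) by ring.
rewrite normrM (gtr0_norm h0).
have H4 : `|h *: v + s *: u| + `|s *: u| <= h * c.
  rewrite (le_trans (lerD (ler_normD _ _) (lexx _)))// !normrZ.
  move: sh => /andP[s0 sh]; rewrite !ger0_norm // ?(ltW h0) // /c.
  by have := normr_ge0 u; have := normr_ge0 v => ? ?; nra.
rewrite expr2 mulrCA (ler_pM2l h0).
apply: (le_trans H3); apply: (le_trans (ler_wpM2l (ltW e0') H4)).
have -> // : e / c * (h * c) = e * h by field; rewrite gt_eqF.
Unshelve. all: by end_near. Qed.

(** Young's form of the symmetry of second derivatives: the first derivatives only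
    have to be differentiable at the point. *)
Lemma derive_comm (V : normedModType R) (f : V -> R) (z u v : V) :
  (\forall y \near z, differentiable f y) ->
  differentiable ('D_u f) z -> differentiable ('D_v f) z ->
  'D_v ('D_u f) z = 'D_u ('D_v f) z.
Proof.
move=> df du dv; apply/eqP; rewrite -subr_eq0 -normr_le0; apply/ler_addgt0Pr => e e0.
rewrite add0r.
have e2 : 0 < e / 2 by rewrite divr_gt0.
have D1 := second_difference_derive v df du e2.
have D2 := second_difference_derive u df dv e2.
have H0 : \forall h \near (0:R)^'+, 0 < h by exact: nbhs_right_gt.
have [h [[h0 H1]]] := @filter_ex _ _ _ _ (filterI (filterI H0 D1) D2).
rewrite second_differenceC => H2.
have h2 : 0 < h ^+ 2 := exprn_gt0 2 h0.
move: H1 H2; set S := second_difference _ _ _ _; set A := 'D_v _ _; set B := 'D_u _ _ => H1 H2.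
have H3 : `|h ^+ 2 * (A - B)| <= h ^+ 2 * e.
  have -> : h ^+ 2 * (A - B) = (S - h ^+ 2 * B) - (S - h ^+ 2 * A) by ring.
  apply: (le_trans (ler_normB _ _)); apply: (le_trans (lerD H2 H1)).
  by rewrite -mulrDl -splitr mulrC.
by rewrite normrM (gtr0_norm h2) ler_pM2l in H3.
Qed.

Lemma near_eq_differentiable (V W : normedModType R) (f g : V -> W) x :
  {near x, f =1 g} -> differentiable f x -> differentiable g x.
Proof.
move=> fg /diff_locallyP [cf Hf].
(* The differential of [f] serves as the differential of [g]. *)
have Hg : g \o shift x = cst (g x) + 'd f x +o_ 0 id.
  apply/eqaddoP => e e0; move/eqaddoP : Hf => /(_ e e0) Hf.
  have fg0 : \forall k \near 0, f (k + x) = g (k + x).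
    by move: fg; rewrite (near_shift 0) /=; apply: filterS => k; rewrite subr0.
  near=> k; rewrite /= !fctE /= -(nbhs_singleton fg).
  rewrite -(_ : f (k + x) = g (k + x)); last by near: k.
  have : `|(f \o shift x - (cst (f x) + 'd f x)) k| <= e * `|id k| by near: k.
  by rewrite !fctE.
apply/diff_locallyP; rewrite (diff_unique cf Hg); split => //.
Unshelve. all: by end_near. Qed.

Lemma differentiable_entry (V : normedModType R) m p (f : V -> 'M[R]_(m, p)) x i j :
  differentiable f x -> differentiable (fun y => f y i j) x.
Proof.
move=> df; exact: (differentiable_comp (g := fun N : 'M[R]_(m, p) => N i j) df
  (differentiable_coord _ _ _)).
Qed.

Lemma derive_entry (V : normedModType R) m p (f : V -> 'M[R]_(m, p)) x v i j :
  derivable f x v -> ('D_v f x) i j = 'D_v (fun y => f y i j) x.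
Proof. by move=> df; rewrite derive_mx // mxE. Qed.

Lemma derive_commM (V : normedModType R) m p (f : V -> 'M[R]_(m, p)) (z u v : V) :
  (\forall y \near z, differentiable f y) ->
  differentiable ('D_u f) z -> differentiable ('D_v f) z ->
  'D_v ('D_u f) z = 'D_u ('D_v f) z.
Proof.
move=> df du dv; apply/matrixP => i j.
have d1 : derivable ('D_u f) z v by exact: diff_derivable.
have d2 : derivable ('D_v f) z u by exact: diff_derivable.
apply: (etrans (derive_entry i j d1)); apply: (etrans _ (esym (derive_entry i j d2))).
have E w : \forall y \near z, 'D_w f y i j = 'D_w (fun y => f y i j) y.
  by apply: filterS df => y dfy; exact: (derive_entry i j (diff_derivable (v := w) dfy)).
have dE w : differentiable ('D_w f) z -> differentiable ('D_w (fun y => f y i j)) z.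
  move=> dw; exact: near_eq_differentiable (E w) (differentiable_entry _ _ dw).
apply: (etrans (near_eq_derive v (E u))).
apply: (etrans _ (esym (near_eq_derive u (E v)))).
apply: derive_comm.
- by apply: filterS df => y; exact: differentiable_entry.
- exact: dE.
- exact: dE.
Qed.

Lemma differentiable_mx (V : normedModType R) m p (f : V -> 'M[R]_(m, p)) x :
  (forall i j, differentiable (fun y => f y i j) x) -> differentiable f x.
Proof.
move=> df; have -> : f = \sum_i \sum_j (fun y => f y i j *: delta_mx i j).
  apply/funext => y; rewrite fct_sumE {1}[f y]matrix_sum_delta.
  by apply: eq_bigr => i _; rewrite fct_sumE.
apply: differentiable_sum => i; apply: differentiable_sum => j.
exact: differentiableZl.
Qed.

Lemma derive_comp (U V W : normedModType R) (f : U -> V) (g : V -> W) x v :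
  differentiable f x -> differentiable g (f x) ->
  'D_v (g \o f) x = 'D_('D_v f x) g (f x).
Proof.
move=> df dg; rewrite deriveE; last exact: differentiable_comp.
by rewrite diff_comp //= !deriveE.
Qed.

(** Both sides are limits of the same difference quotient. *)
Lemma derive_affine (U V W : normedModType R) (g : V -> W) (iota : U -> V) x v w :
  (forall s : R, iota (s *: v + x) = s *: w + iota x) ->
  'D_v (g \o iota) x = 'D_w g (iota x).
Proof.
move=> io; rewrite /derive.
have -> : (fun h : R => h^-1 *: ((g \o iota \o shift x) (h *: v) - (g \o iota) x)) =
  (fun h : R => h^-1 *: ((g \o shift (iota x)) (h *: w) - g (iota x))) by
  apply/funext => s /=; rewrite io.
by [].
Qed.

Lemma is_derive_invariant (U V W : normedModType R) (g : V -> W) (pi : U -> V) x v :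
  (forall s : R, pi (s *: v + x) = pi x) -> is_derive x v (g \o pi) 0.
Proof.
move=> io.
have E : (fun h : R => h^-1 *: ((g \o pi \o shift x) (h *: v) - (g \o pi) x)) = cst 0.
  by apply/funext => h /=; rewrite io subrr scaler0.
by apply: DeriveDef; rewrite /derivable /derive E; [exact: is_cvg_cst|exact: lim_cst].
Qed.

Lemma derive_sum_partial (n : nat) (W : normedModType R) (f : 'rV[R]_n -> W) x v :
  differentiable f x -> 'D_v f x = \sum_c v 0 c *: partial c f x.
Proof.
move=> df; rewrite deriveE // {1}[v]row_sum_delta linear_sum /=.
by apply: eq_bigr => c _; rewrite linearZ /= /partial deriveE.
Qed.

Lemma is_derive_bigsum (V W : normedModType R) (I : finType) (h : I -> V -> W) (dh : I -> W)
    (x v : V) :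
  (forall i, is_derive x v (h i) (dh i)) ->
  is_derive x v (fun y => \sum_i h i y) (\sum_i dh i).
Proof.
move=> H; have E : (fun y => \sum_i h i y) = \sum_i h i by apply/funext => y; rewrite fct_sumE.
rewrite E; elim/big_ind2 : _ => [|f df g dg Hf Hg|i _]; last exact: H.
  exact: is_derive_cst.
exact: is_deriveD.
Qed.

End Calculus.

(** * Killing fields and conserved momenta *)

Section Noether.
Context {R : realType} {n : nat}.
Implicit Types (G : 'rV[R]_n -> 'M[R]_n) (K : 'rV[R]_n -> 'rV[R]_n).

(** The Christoffel symbols of the metric [G] of an open set of coordinates. *)
Definition levi_civita G (x : 'rV[R]_n) (i j k : 'I_n) : R :=
  2^-1 * \sum_l invmx (G x) k l *
    (partial i (fun y => G y j l) x + partial j (fun y => G y i l) x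
     - partial l (fun y => G y i j) x).

(** The Lie derivative of the metric [G] along [K] vanishes at [x]. *)
Definition killing G K (x : 'rV[R]_n) : Prop := forall i j,
  \sum_a (partial i (fun y => K y 0 a) x * G x a j +
          partial j (fun y => K y 0 a) x * G x i a +
          K x 0 a * partial a (fun y => G y i j) x) = 0.

Lemma lower_levi_civita G x i j a : (G x)^T = G x -> G x \in unitmx ->
  \sum_k levi_civita G x i j k * G x k a =
  2^-1 * (partial i (fun y => G y j a) x + partial j (fun y => G y i a) x
     - partial a (fun y => G y i j) x).
Proof.
move=> sG uG.
pose T l := partial i (fun y => G y j l) x + partial j (fun y => G y i l) x
     - partial l (fun y => G y i j) x.
rewrite -[RHS]/(2^-1 * T a).
have E k : levi_civita G x i j k * G x k a =
    2^-1 * \sum_l T l * ((invmx (G x)) k l * G x k a).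
  rewrite /levi_civita -mulrA mulr_suml; congr (_ * _); apply: eq_bigr => l _.
  by rewrite mulrAC mulrC.
under eq_bigr do rewrite E.
rewrite -mulr_sumr exchange_big /=; congr (_ * _).
under eq_bigr do rewrite -mulr_sumr.
rewrite (bigD1 a) //= [X in _ + X]big1 => [|l la].
  rewrite addr0 -[RHS]mulr1; congr (_ * _).
  have /matrixP/(_ a a) : G x *m invmx (G x) = 1%:M by rewrite mulmxV.
  rewrite !mxE eqxx mulr1n => H; rewrite -[RHS]H; apply: eq_bigr => k _; rewrite mulrC.
  by rewrite -{1}sG mxE.
rewrite -[RHS](mulr0 (T l)); congr (_ * _).
have /matrixP/(_ a l) : G x *m invmx (G x) = 1%:M by rewrite mulmxV.
rewrite !mxE eq_sym (negbTE la) mulr0n => H; rewrite -[RHS]H; apply: eq_bigr => k _; rewrite mulrC.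
by rewrite -{1}sG mxE.
Qed.

Definition momentum G K (x v : 'rV[R]_n) : R := \sum_i \sum_a v 0 i * G x i a * K x 0 a.

(** The Killing equation contracted twice with [v]; the two terms in the derivative
    of [K] coincide by symmetry of [G]. *)
Lemma killing_contract G K x (v : 'rV[R]_n) : (G x)^T = G x -> killing G K x ->
  \sum_i \sum_j \sum_a v 0 i * v 0 j * (K x 0 a * partial a (fun y => G y i j) x) =
  - 2 * \sum_i \sum_j \sum_a v 0 i * v 0 j * (partial j (fun y => K y 0 a) x * G x i a).
Proof.
move=> sG kil.
have : \sum_i \sum_j v 0 i * v 0 j * \sum_a (partial i (fun y => K y 0 a) x * G x a j +
          partial j (fun y => K y 0 a) x * G x i a +
          K x 0 a * partial a (fun y => G y i j) x) = 0.
  by apply: big1 => i _; apply: big1 => j _; rewrite kil mulr0.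
under eq_bigr do under eq_bigr do rewrite mulr_sumr.
under eq_bigr do under eq_bigr do under eq_bigr do rewrite !mulrDr.
under eq_bigr do under eq_bigr do rewrite !big_split.
under eq_bigr do rewrite !big_split.
rewrite !big_split /=.
set A := (X in X + _ + _); set B := (X in _ + X + _); set C := (X in _ + _ + X).
have -> : A = B.
  rewrite /A exchange_big; apply: eq_bigr => i _; apply: eq_bigr => j _.
  apply: eq_bigr => a _; rewrite (mulrC (v 0 j)); congr (_ * (_ * _)).
  by rewrite -{1}sG mxE.
move=> H; change (C = - 2 * B); lra.
Qed.

Definition covariant_acceleration G (x : R -> 'rV[R]_n) (t : R) : 'rV[R]_n :=
  let x' := x^`()%classic in
  \row_k (x'^`()%classic t 0 k +
    \sum_i \sum_j levi_civita G (x t) i j k * x' t 0 i * x' t 0 j).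

(** Differentiating [G x' K] produces [G x'' K], a term in [dG] and a term in [dK].
    The Killing equation, contracted twice with [x'], trades the last one for
    [- (1/2) K dG x' x'], and what remains of [dG] is the lowered Christoffel symbol. *)
Lemma noether G K (x : R -> 'rV[R]_n) t :
  derivable x t 1 -> derivable x^`()%classic t 1 ->
  differentiable G (x t) -> differentiable K (x t) ->
  (G (x t))^T = G (x t) -> G (x t) \in unitmx -> killing G K (x t) ->
  is_derive t 1 (fun s => momentum G K (x s) (x^`()%classic s))
    (momentum G K (x t) (covariant_acceleration G x t)).
Proof.
set x' := x^`()%classic => dx dx' dG dK sG uG kil.
have dG' i j : is_derive t 1 (fun s => G (x s) i j)
    (\sum_c x' t 0 c * partial c (fun y => G y i j) (x t)).
  have dGij := differentiable_entry i j dG.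
  have := is_derive_curve dGij dx.
  by rewrite derive_sum_partial.
have dK' a : is_derive t 1 (fun s => K (x s) 0 a)
    (\sum_c x' t 0 c * partial c (fun y => K y 0 a) (x t)).
  have dKa := differentiable_entry 0 a dK.
  have := is_derive_curve dKa dx.
  by rewrite derive_sum_partial.
have dv i : is_derive t 1 (fun s => x' s 0 i) (x'^`()%classic t 0 i).
  rewrite derive1E derive_entry //; apply: derivableP.
  exact: (proj1 (derivable_mxP _ _ _) dx').
have D : is_derive t 1 (fun s => momentum G K (x s) (x' s))
  (\sum_i \sum_a (x' t 0 i * G (x t) i a * (\sum_c x' t 0 c * partial c (fun y => K y 0 a) (x t))
    + K (x t) 0 a * (x' t 0 i * (\sum_c x' t 0 c * partial c (fun y => G y i a) (x t))
       + G (x t) i a * x'^`()%classic t 0 i))).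
  apply: is_derive_bigsum => i; apply: is_derive_bigsum => a.
  have d1 := is_deriveM (dv i) (dG' i a).
  exact: (is_deriveM d1 (dK' a)).
apply: is_derive_eq D _.
have -> : momentum G K (x t) (covariant_acceleration G x t) =
    momentum G K (x t) (x'^`()%classic t) +
    \sum_a K (x t) 0 a * \sum_i \sum_j x' t 0 i * x' t 0 j * (2^-1 *
      (partial i (fun y => G y j a) (x t) + partial j (fun y => G y i a) (x t)
     - partial a (fun y => G y i j) (x t))).
  rewrite /momentum; under eq_bigr do under eq_bigr do rewrite mxE !mulrDl.
  under eq_bigr do rewrite big_split.
  rewrite big_split /=; congr (_ + _).
  rewrite exchange_big /=; apply: eq_bigr => a _.
  under eq_bigr do rewrite mulrC.
  rewrite -mulr_sumr; congr (_ * _).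
  under [LHS]eq_bigr => k _ do rewrite big_distrl /=.
  rewrite [LHS]exchange_big /=; apply: eq_bigr => i _.
  under [LHS]eq_bigr do rewrite big_distrl /=.
  rewrite [LHS]exchange_big /=; apply: eq_bigr => j _.
  rewrite -(lower_levi_civita i j a sG uG) mulr_sumr; apply: eq_bigr => k _.
  by rewrite -/x'; ring.
set P := \sum_a K _ _ _ * _.
have EP : P = \sum_i \sum_j \sum_a x' t 0 i * x' t 0 j * (K (x t) 0 a * partial j (fun y => G y i a) (x t))
   - 2^-1 * \sum_i \sum_j \sum_a x' t 0 i * x' t 0 j * (K (x t) 0 a * partial a (fun y => G y i j) (x t)).
  pose A1 := \sum_i \sum_j \sum_a x' t 0 i * x' t 0 j * (K (x t) 0 a * partial i (fun y => G y j a) (x t)).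
  pose A2 := \sum_i \sum_j \sum_a x' t 0 i * x' t 0 j * (K (x t) 0 a * partial j (fun y => G y i a) (x t)).
  pose A3 := \sum_i \sum_j \sum_a x' t 0 i * x' t 0 j * (K (x t) 0 a * partial a (fun y => G y i j) (x t)).
  have -> : P = 2^-1 * (A1 + A2 - A3).
    rewrite /P /A1 /A2 /A3 -sumrN -!big_split mulr_sumr.
    under eq_bigr do rewrite mulr_sumr.
    rewrite exchange_big /=; apply: eq_bigr => i _.
    rewrite -sumrN -!big_split mulr_sumr.
    under eq_bigr do rewrite mulr_sumr.
    rewrite exchange_big /=; apply: eq_bigr => j _.
    rewrite -sumrN -!big_split mulr_sumr; apply: eq_bigr => a _ /=; ring.
  have -> : A1 = A2.
    rewrite /A1 exchange_big; apply: eq_bigr => i _; apply: eq_bigr => j _.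
    by apply: eq_bigr => a _; rewrite (mulrC (x' t 0 j)).
  rewrite -/A2 -/A3; lra.
rewrite EP (killing_contract (x' t) sG kil).
set T1 := \sum_i \sum_j \sum_a x' t 0 i * x' t 0 j * (partial j (fun y => K y 0 a) (x t) * G (x t) i a).
set T2 := \sum_i \sum_j \sum_a x' t 0 i * x' t 0 j * (K (x t) 0 a * partial j (fun y => G y i a) (x t)).
set M := momentum G K (x t) _.
rewrite (_ : \sum_i _ = T1 + T2 + M); first lra.
rewrite /M /momentum -!big_split; apply: eq_bigr => i _ /=.
rewrite [X in _ = X + _ + _]exchange_big [X in _ = _ + X + _]exchange_big /= -!big_split.
apply: eq_bigr => a _ /=; rewrite mulrDr addrA; congr (_ + _ + _); last by ring.
  by rewrite mulr_sumr; apply: eq_bigr => c _; ring.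
by rewrite !mulr_sumr; apply: eq_bigr => c _; ring.
Qed.

End Noether.

Section KillingOfIsometries.
Context {R : realType} {n N : nat}.

(** [F] is a family of isometries in coordinates: [z] encodes a point [pi z] and a
    parameter, the coordinates [alpha i] of [z] move the point, the coordinate [beta]
    moves the parameter, and [iota] inserts the parameter of the identity map.
    Differentiating the isometry identity along [beta] gives the Killing equation
    for the velocity of the family, after exchanging the derivatives along [beta]
    and along [alpha i]. *)
Lemma killing_of_isometries (G : 'rV[R]_n -> 'M[R]_n) (F : 'rV[R]_N -> 'rV[R]_n)
    (alpha : 'I_n -> 'I_N) (beta : 'I_N) (pi : 'rV[R]_N -> 'rV[R]_n)
    (iota : 'rV[R]_n -> 'rV[R]_N) (x0 : 'rV[R]_n) :
  let z0 := iota x0 in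
  (forall x s i, iota (s *: delta_mx 0 i + x) = s *: delta_mx 0 (alpha i) + iota x) ->
  (forall z s, pi (s *: delta_mx 0 beta + z) = pi z) ->
  F z0 = x0 -> (forall i, partial (alpha i) F z0 = delta_mx 0 i) ->
  (\forall z \near z0, differentiable F z) ->
  (forall i, differentiable (partial (alpha i) F) z0) ->
  differentiable (partial beta F) z0 ->
  differentiable G x0 ->
  (\forall z \near z0, forall i j, G (pi z) i j = \sum_a \sum_b
     partial (alpha i) F z 0 a * G (F z) a b * partial (alpha j) F z 0 b) ->
  killing G (fun x => partial beta F (iota x)) x0.
Proof.
move=> z0 io pib Fz0 Fid dF dFa dFb dG isoF i j.
have dFz0 := nbhs_singleton dF.
set K := fun x => partial beta F (iota x).
have [W [dK dA]] : exists W : 'I_n -> 'rV[R]_n,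
    (forall k a, partial k (fun y => K y 0 a) x0 = W k 0 a) /\
    (forall k a, is_derive z0 (delta_mx 0 beta) (fun z => partial (alpha k) F z 0 a) (W k 0 a)).
  exists (fun k => partial beta (partial (alpha k) F) z0); split=> k a.
    have d1 : derivable (partial beta F) z0 (delta_mx 0 (alpha k)) := diff_derivable dFb.
    have e1 := derive_affine (fun z => partial beta F z 0 a) (fun s => io x0 s k).
    apply: (etrans e1); apply: (etrans (esym (derive_entry 0 a d1))).
    exact: (congr1 (fun M : 'rV[R]_n => M 0 a) (derive_commM dF dFb (dFa k))).
  have d1 : derivable (partial (alpha k) F) z0 (delta_mx 0 beta) := diff_derivable (dFa k).
  have d2 := diff_derivable (v := delta_mx 0 beta) (differentiable_entry 0 a (dFa k)).
  by have := derivableP d2; rewrite -(derive_entry 0 a d1).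
pose f i j a b := fun z => partial (alpha i) F z 0 a * G (F z) a b * partial (alpha j) F z 0 b.
have dGF a b : is_derive z0 (delta_mx 0 beta) (fun z => G (F z) a b)
    (\sum_c K x0 0 c * partial c (fun y => G y a b) x0).
  have dGab : differentiable (fun y => G y a b) (F z0).
    by rewrite Fz0; exact: differentiable_entry.
  have -> : \sum_c K x0 0 c * partial c (fun y => G y a b) x0 =
      'D_(delta_mx 0 beta) ((fun y => G y a b) \o F) z0.
    by rewrite derive_comp // derive_sum_partial // Fz0.
  apply: derivableP; apply: diff_derivable.
  exact: (differentiable_comp (g := fun y => G y a b)).
(* The isometry identity equates this sum with the metric at [pi z], which is constant
   along [beta]. *)
have D0 : is_derive z0 (delta_mx 0 beta) (fun z => \sum_a \sum_b f i j a b z) 0.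
  have D := is_derive_invariant (fun y => G y i j) (pib z0).
  by apply: near_eq_is_derive D; apply: filterS isoF => z; exact.
pose e k b := (delta_mx 0 k : 'rV[R]_n) 0 b.
have D1 : is_derive z0 (delta_mx 0 beta) (fun z => \sum_a \sum_b f i j a b z)
  (\sum_a \sum_b (e i a * G x0 a b * W j 0 b +
     e j b * (e i a * (\sum_c K x0 0 c * partial c (fun y => G y a b) x0)
       + G x0 a b * W i 0 a))).
  apply: is_derive_bigsum => a; apply: is_derive_bigsum => b.
  have d1 := is_deriveM (dA i a) (dGF a b).
  apply: is_derive_eq (is_deriveM d1 (dA j b)) _.
  change (partial (alpha i) F z0 0 a * G (F z0) a b * W j 0 b +
    partial (alpha j) F z0 0 b * (partial (alpha i) F z0 0 a * 
      (\sum_c K x0 0 c * partial c (fun y => G y a b) x0) + G (F z0) a b * W i 0 a) =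
    e i a * G x0 a b * W j 0 b + e j b * (e i a *
     (\sum_c K x0 0 c * partial c (fun y => G y a b) x0) + G x0 a b * W i 0 a)).
  by rewrite !Fid Fz0.
have := @derive_val _ _ _ _ _ _ _ D1; rewrite (@derive_val _ _ _ _ _ _ _ D0) => H.
have pick k (h : 'I_n -> R) : \sum_b e k b * h b = h k.
  rewrite (bigD1 k) //= /e mxE !eqxx mul1r big1 ?addr0 // => l lk.
  by rewrite mxE (negbTE lk) andbF mul0r.
rewrite [RHS]H.
have -> : \sum_a \sum_b (e i a * G x0 a b * W j 0 b + e j b * (e i a *
     (\sum_c K x0 0 c * partial c (fun y => G y a b) x0) + G x0 a b * W i 0 a)) =
  \sum_a e i a * (\sum_b G x0 a b * W j 0 b) +
  (\sum_b e j b * (\sum_a e i a * (\sum_c K x0 0 c * partial c (fun y => G y a b) x0)) +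
   \sum_b e j b * (\sum_a G x0 a b * W i 0 a)).
  rewrite -[X in _ = _ + X]big_split /= [X in _ = _ + X](eq_bigr (fun b => \sum_a e j b *
    (e i a * (\sum_c K x0 0 c * partial c (fun y => G y a b) x0) + G x0 a b * W i 0 a))).
    rewrite [X in _ = _ + X]exchange_big /= -big_split; apply: eq_bigr => a _ /=.
    by rewrite mulr_sumr -big_split; apply: eq_bigr => b _ /=; rewrite mulrA.
  by move=> b _; rewrite -mulrDr -big_split mulr_sumr.
pose S1 := \sum_b G x0 i b * W j 0 b; pose S3 := \sum_a G x0 a j * W i 0 a.
pose S2 := \sum_c K x0 0 c * partial c (fun y => G y i j) x0.
apply: (@etrans _ _ (S1 + (S2 + S3))); last first.
  congr (_ + (_ + _)).
  - exact: esym (pick i (fun a => \sum_b G x0 a b * W j 0 b)).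
  - apply: esym; apply: etrans (pick j (fun b => _)) _.
    exact: (pick i (fun a => \sum_c K x0 0 c * partial c (fun y => G y a j) x0)).
  - exact: esym (pick j (fun b => \sum_a G x0 a b * W i 0 a)).
rewrite addrA (addrC (S1 + S2)) addrA /S1 /S2 /S3 -!big_split.
apply: eq_bigr => a _ /=.
apply: (etrans (y := W i 0 a * G x0 a j + W j 0 a * G x0 i a + K x0 0 a * partial a (fun y => G y i j) x0)).
  congr (_ * _ + _ * _ + _); [exact: dK | exact: dK].
move: (partial a _ _) (K x0 0 a) => *; ring.
Qed.

End KillingOfIsometries.

(** * Maps and curves in charts *)

Lemma open_nbhs_mem (T : topologicalType) (A : set T) x : open A -> A x -> nbhs x A.
Proof. by move=> oA Ax; apply: open_nbhs_nbhs. Qed.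

Section Charts.
Context {R : realType} {n : nat} {M : manifoldType R n}.
Implicit Types (p q r s : M) (f g : M -> M).

Definition in_chart q p := chart_dom (chart_at q) p.

Lemma in_chart_self p : in_chart p p. Proof. exact: mem_chart_at. Qed.

Lemma in_chart_near q p : in_chart q p -> \forall y \near p, in_chart q y.
Proof. by apply: open_nbhs_mem; exact: (@open_chart_dom _ _ _ (chart_at q)). Qed.

Lemma chartK q p : in_chart q p -> chart_inv (chart_at q) (chart_at q p) = p.
Proof. by move=> qp; rewrite chart_funK // inE. Qed.

Lemma mem_codom q p : in_chart q p -> chart_codom (chart_at q) (chart_at q p).
Proof. by move=> qp; exists p. Qed.

Lemma chart_codomP q x : chart_codom (chart_at q) x ->
  exists2 p, in_chart q p & x = chart_at q p.
Proof. by case=> p qp <-; exists p. Qed.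

Lemma chart_continuous q p : in_chart q p -> {for p, continuous (chart_at q)}.
Proof.
move=> qp; have := @chart_fun_continuous _ _ _ (chart_at q).
by rewrite (continuous_open_subspace _ (@open_chart_dom _ _ _ (chart_at q))) => /(_ p); apply; rewrite inE.
Qed.

Lemma codom_near q p : in_chart q p ->
  \forall x \near chart_at q p, chart_codom (chart_at q) x.
Proof. by move=> qp; apply: open_nbhs_mem; [exact: (@open_chart_codom _ _ _ (chart_at q))|exact: mem_codom]. Qed.

Lemma chart_inv_cvg q p : in_chart q p ->
  {for chart_at q p, continuous (chart_inv (chart_at q))}.
Proof.
move=> qp; have := @chart_inv_continuous _ _ _ (chart_at q).
rewrite (continuous_open_subspace _ (@open_chart_codom _ _ _ (chart_at q))).
by move=> /(_ (chart_at q p)); apply; rewrite inE; exists p.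
Qed.

Lemma near_chart_inv q p (P : set M) : in_chart q p -> nbhs p P ->
  \forall x \near chart_at q p, P (chart_inv (chart_at q) x).
Proof.
by move=> qp Pp; apply: (chart_inv_cvg qp); rewrite /= chartK.
Qed.

Definition local_rep q r f : 'rV[R]_n -> 'rV[R]_n :=
  chart_at r \o f \o chart_inv (chart_at q).

(** The tangent map of [f] at [p] in these charts; for [f] the identity it changes the
    coordinates of tangent vectors at [p] from the chart at [q] to the chart at [r]. *)
Definition local_derive q r f p v : 'rV[R]_n := 'D_v (local_rep q r f) (chart_at q p).

Definition local_diff q r f p := differentiable (local_rep q r f) (chart_at q p).

Definition diff_at f p := {for p, continuous f} /\ local_diff p (f p) f p.

Lemma local_rep_comp_near q s r f g p : in_chart q p -> in_chart s (f p) ->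
  {for p, continuous f} ->
  \forall x \near chart_at q p, (local_rep s r g \o local_rep q s f) x = local_rep q r (g \o f) x.
Proof.
move=> qp sf cf; have H : \forall y \near p, in_chart s (f y) by apply: cf; exact: in_chart_near.
by apply: filterS (near_chart_inv qp H) => x sx; rewrite /local_rep /= chartK.
Qed.

Lemma local_repE q r f p : in_chart q p -> local_rep q r f (chart_at q p) = chart_at r (f p).
Proof. by move=> qp; rewrite /local_rep /= chartK. Qed.

(** The chain rule in charts.  Every other rule on tangent maps and changes of chart
    is an instance, with identity maps among [f] and [g]. *)
Lemma local_diff_comp q s r f g p : in_chart q p -> in_chart s (f p) ->
  {for p, continuous f} -> local_diff q s f p -> local_diff s r g (f p) ->
  local_diff q r (g \o f) p /\
  forall v, local_derive q r (g \o f) p v = local_derive s r g (f p) (local_derive q s f p v).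
Proof.
move=> qp sf cf df dg.
have dg' : differentiable (local_rep s r g) (local_rep q s f (chart_at q p)) by rewrite local_repE.
have E := local_rep_comp_near r g qp sf cf.
split.
  exact: near_eq_differentiable E (differentiable_comp df dg').
move=> v; rewrite /local_derive -(near_eq_derive v E) (derive_comp v df dg').
by rewrite local_repE.
Qed.

Lemma local_diff_id q r p : in_chart q p -> in_chart r p -> local_diff q r id p.
Proof.
move=> qp rp; have := @chart_transition_smooth R n M q r [::] (chart_at q p).
by apply; split; [exact: mem_codom | rewrite /= chartK].
Qed.

Lemma continuous_idM p : {for p, continuous (@id M)}. Proof. by []. Qed.

Lemma local_derive_id q p v : in_chart q p -> local_derive q q id p v = v.
Proof.
move=> qp; rewrite /local_derive.
have E : \forall x \near chart_at q p, id x = local_rep q q id x.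
  by apply: filterS (codom_near qp) => x /chart_codomP[y qy ->]; rewrite local_repE.
by rewrite -(near_eq_derive v E) derive_id.
Qed.

Lemma local_derive_idK q r p v : in_chart q p -> in_chart r p ->
  local_derive r q id p (local_derive q r id p v) = v.
Proof.
move=> qp rp.
have [_ <-] := local_diff_comp qp rp (@continuous_idM p) (local_diff_id qp rp) (local_diff_id rp qp).
exact: local_derive_id.
Qed.

Lemma diff_at_local f p q r : diff_at f p -> in_chart q p -> in_chart r (f p) ->
  local_diff q r f p.
Proof.
move=> [cf df] qp rf.
have d1 := (local_diff_comp qp (in_chart_self p) (@continuous_idM p)
  (local_diff_id qp (in_chart_self p)) df).1.
exact: (local_diff_comp (g := id) qp (in_chart_self (f p)) cf d1 (local_diff_id (in_chart_self (f p)) rf)).1.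
Qed.

Lemma local_diff_at f p q r : in_chart q p -> in_chart r (f p) ->
  {for p, continuous f} -> local_diff q r f p -> diff_at f p.
Proof.
move=> qp rf cf df; split => //.
have d1 := (local_diff_comp (in_chart_self p) qp (@continuous_idM p)
  (local_diff_id (in_chart_self p) qp) df).1.
exact: (local_diff_comp (g := id) (in_chart_self p) rf cf d1 (local_diff_id rf (in_chart_self (f p)))).1.
Qed.

Lemma local_derive_comp f g p q s r v : diff_at f p -> diff_at g (f p) ->
  in_chart q p -> in_chart s (f p) -> in_chart r (g (f p)) ->
  local_derive q r (g \o f) p v = local_derive s r g (f p) (local_derive q s f p v).
Proof.
move=> df dg qp sf rg.
by have [_ ->] := local_diff_comp qp sf df.1 (diff_at_local df qp sf) (diff_at_local dg sf rg).
Qed.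

Lemma diff_at_comp f g p : diff_at f p -> diff_at g (f p) -> diff_at (g \o f) p.
Proof.
move=> df dg; split; first exact: (continuous_comp df.1 dg.1).
have fp := in_chart_self (f p); have pp := in_chart_self p.
exact: (local_diff_comp pp fp df.1 (diff_at_local df pp fp) (diff_at_local dg fp (in_chart_self _))).1.
Qed.

Lemma tangent_mapE f p v : tangent_map f p v = local_derive p (f p) f p v.
Proof. by []. Qed.

Lemma diff_at_id p : diff_at id p.
Proof. by split => //; apply: local_diff_id; exact: in_chart_self. Qed.

Lemma tangent_map_comp f g p v : diff_at f p -> diff_at g (f p) ->
  tangent_map (g \o f) p v = tangent_map g (f p) (tangent_map f p v).
Proof.
by move=> df dg; apply: local_derive_comp => //; exact: in_chart_self.
Qed.

Lemma local_derive_tangent f p q r v : diff_at f p -> in_chart q p -> in_chart r (f p) ->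
  local_derive r (f p) id (f p) (local_derive q r f p v) = tangent_map f p (local_derive q p id p v).
Proof.
move=> df qp rf; rewrite tangent_mapE.
have pp := in_chart_self p; have fp := in_chart_self (f p).
apply: (etrans (esym (local_derive_comp v df (diff_at_id _) qp rf fp))).
exact: (local_derive_comp v (diff_at_id p) df qp pp fp).
Qed.

Lemma local_derive_linear q r f p : local_diff q r f p ->
  forall v, local_derive q r f p v = \sum_c v 0 c *: local_derive q r f p (delta_mx 0 c).
Proof. by move=> df v; rewrite /local_derive derive_sum_partial. Qed.

Lemma tangent_map_linear f p : diff_at f p ->
  forall v, tangent_map f p v = \sum_c v 0 c *: tangent_map f p (delta_mx 0 c).
Proof. by move=> [_ df] v; exact: (local_derive_linear df). Qed.

Definition curve_diff (c : R -> M) t :=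
  {for t, continuous c} /\ derivable (chart_at (c t) \o c) t 1.

Lemma curve_diff_chart (c : R -> M) t q r : {for t, continuous c} ->
  in_chart q (c t) -> in_chart r (c t) -> derivable (chart_at q \o c) t 1 ->
  is_derive t 1 (chart_at r \o c) (local_derive q r id (c t) ((chart_at q \o c)^`()%classic t)).
Proof.
move=> cc qc rc dq.
have d1 := is_derive_curve (local_diff_id qc rc) dq.
apply: (near_eq_is_derive _ d1).
have : \forall s \near t, in_chart q (c s) by apply: cc; exact: in_chart_near.
by apply: filterS => s qs; rewrite /= local_repE.
Qed.

Lemma curve_diff_derivable (c : R -> M) t q : curve_diff c t -> in_chart q (c t) ->
  derivable (chart_at q \o c) t 1.
Proof. by move=> [cc dc] qc; have [] := curve_diff_chart cc (in_chart_self _) qc dc. Qed.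

Lemma velocity_chart (c : R -> M) t q : curve_diff c t -> in_chart q (c t) ->
  velocity c t = local_derive q (c t) id (c t) ((chart_at q \o c)^`()%classic t).
Proof.
move=> dc qc; rewrite /velocity derive1E.
by have [_ ->] := curve_diff_chart dc.1 qc (in_chart_self _) (curve_diff_derivable dc qc).
Qed.

Lemma local_rep_curve_near f (c : R -> M) t q r : {for t, continuous c} -> in_chart q (c t) ->
  \forall s \near t, (local_rep q r f \o (chart_at q \o c)) s = (chart_at r \o (f \o c)) s.
Proof.
move=> cc qc.
have : \forall s \near t, in_chart q (c s) by apply: cc; exact: in_chart_near.
by apply: filterS => s qs; rewrite /= local_repE.
Qed.

Lemma is_derive_local_rep_curve f (c : R -> M) t q r : diff_at f (c t) -> curve_diff c t ->
  in_chart q (c t) -> in_chart r (f (c t)) ->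
  is_derive t 1 (chart_at r \o (f \o c)) (local_derive q r f (c t) ((chart_at q \o c)^`()%classic t)).
Proof.
move=> df dc qc rf.
apply: (near_eq_is_derive (local_rep_curve_near f r dc.1 qc)).
exact: (is_derive_curve (diff_at_local df qc rf) (curve_diff_derivable dc qc)).
Qed.

Lemma velocity_comp f (c : R -> M) t : diff_at f (c t) -> curve_diff c t ->
  velocity (f \o c) t = tangent_map f (c t) (velocity c t).
Proof.
move=> df dc; rewrite /velocity derive1E.
by have [_ ->] := is_derive_local_rep_curve df dc (in_chart_self _) (in_chart_self _).
Qed.

(** The regularity that the geodesic equation presupposes. *)
Definition C2_on (I : set R) (c : R -> M) := forall t, I t -> {for t, continuous c} /\
  forall q, in_chart q (c t) -> derivable (chart_at q \o c) t 1 /\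
    derivable ((chart_at q \o c)^`()%classic) t 1.

Lemma C2_curve_diff I c t : C2_on I c -> I t -> curve_diff c t.
Proof.
by move=> C It; have [cc /(_ (c t) (in_chart_self _))[]] := C t It.
Qed.

End Charts.

(** * The metric in charts *)

Lemma posdef_unitmx (R : realFieldType) n (A : 'M[R]_n) :
  (forall v : 'rV[R]_n, v != 0 -> 0 < (v *m A *m v^T) 0 0) -> A \in unitmx.
Proof.
move=> posA; rewrite -row_free_unit -kermx_eq0; apply/rowV0P => v /sub_kermxP vA.
by apply/eqP/negPn/negP => /posA; rewrite vA mul0mx mxE ltxx.
Qed.

Lemma quadratic_entry (R : comNzRingType) m n (A : 'M[R]_n) (J : 'M[R]_(m, n)) i j :
  (row i J *m A *m (row j J)^T) 0 0 = (J *m A *m J^T) i j.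
Proof.
rewrite -row_mul !mxE; apply: eq_bigr => k _.
by rewrite !mxE.
Qed.

Section Metric.
Context {R : realType} {n : nat} {M : manifoldType R n}.
Variable g : riemannian_metric M.
Implicit Types (p q r s : M) (f h : M -> M).

Local Notation G q := (local_gram (gram g) q).

Lemma inner_sum p u (I : finType) (a : I -> R) (w : I -> 'rV[R]_n) :
  inner g p u (\sum_i a i *: w i) = \sum_i a i * inner g p u (w i).
Proof.
rewrite /inner linear_sum /= mulmx_sumr summxE; apply: eq_bigr => i _.
by rewrite linearZ /= -scalemxAr mxE.
Qed.

Lemma innerC p u v : inner g p u v = inner g p v u.
Proof.
have E (A : 'M[R]_1) : A 0 0 = A^T 0 0 by rewrite mxE.
by rewrite /inner E !trmx_mul trmxK gram_sym mulmxA.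
Qed.

Lemma inner_suml p (I : finType) (a : I -> R) (w : I -> 'rV[R]_n) v :
  inner g p (\sum_i a i *: w i) v = \sum_i a i * inner g p (w i) v.
Proof. by rewrite innerC inner_sum; apply: eq_bigr => i _; rewrite innerC. Qed.

Lemma inner_eq0 p v : inner g p v v = 0 -> v = 0.
Proof.
move=> v0; apply/eqP/negPn/negP => /(@gram_posdef _ _ _ g p).
by rewrite -[X in 0 < X]/(inner g p v v) v0 ltxx.
Qed.

Lemma local_gramE q p i j : in_chart q p ->
  G q (chart_at q p) i j =
  inner g p (local_derive q p id p (delta_mx 0 i)) (local_derive q p id p (delta_mx 0 j)).
Proof.
move=> qp; rewrite /local_gram chartK //.
set J := \matrix_(_ < _) _.
have rJ k : row k J = local_derive q p id p (delta_mx 0 k) by apply/rowP => a; rewrite !mxE.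
by rewrite /inner -!rJ quadratic_entry.
Qed.

(** The local Gram matrix is the metric transported to the coordinates of the chart
    at [q]. *)
Lemma inner_chart q p v w : in_chart q p ->
  inner g p (local_derive q p id p v) (local_derive q p id p w) =
  \sum_i \sum_a v 0 i * G q (chart_at q p) i a * w 0 a.
Proof.
move=> qp; have d := local_diff_id qp (in_chart_self p).
rewrite (local_derive_linear d v) inner_suml; apply: eq_bigr => i _.
rewrite (local_derive_linear d w) inner_sum mulr_sumr; apply: eq_bigr => a _.
by rewrite (local_gramE i a qp) mulrCA mulrC.
Qed.

Lemma local_gram_sym q p : in_chart q p -> (G q (chart_at q p))^T = G q (chart_at q p).
Proof.
move=> qp; apply/matrixP => i j; rewrite mxE.
apply: (etrans (local_gramE j i qp)); apply: etrans (innerC _ _ _) _.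
exact: esym (local_gramE i j qp).
Qed.

Lemma local_gram_unit q p : in_chart q p -> G q (chart_at q p) \in unitmx.
Proof.
move=> qp; apply: posdef_unitmx => v v0.
have -> : (v *m G q (chart_at q p) *m v^T) 0 0 =
    inner g p (local_derive q p id p v) (local_derive q p id p v).
  rewrite inner_chart // mxE exchange_big; apply: eq_bigr => a _ /=.
  by rewrite !mxE mulr_suml; apply: eq_bigr => i _; rewrite mxE.
apply: gram_posdef; apply: contra v0 => /eqP v0.
have d := local_diff_id (in_chart_self p) qp.
by rewrite -(local_derive_idK v qp (in_chart_self p)) v0 (local_derive_linear d) big1 // => c _; rewrite mxE scale0r.
Qed.

Lemma local_gram_diff q p : in_chart q p -> differentiable (G q) (chart_at q p).
Proof. by move=> qp; apply: (gram_smooth g [::]); exact: mem_codom. Qed.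

Lemma local_gram_isometric f p q r i j : isometric g f -> diff_at f p ->
  in_chart q p -> in_chart r (f p) ->
  G q (chart_at q p) i j = \sum_a \sum_b
    local_derive q r f p (delta_mx 0 i) 0 a * G r (chart_at r (f p)) a b * local_derive q r f p (delta_mx 0 j) 0 b.
Proof.
move=> isof df qp rf; apply: (etrans (local_gramE i j qp)).
apply: etrans _ (inner_chart _ _ rf).
rewrite (local_derive_tangent (delta_mx 0 i) df qp rf) (local_derive_tangent (delta_mx 0 j) df qp rf).
exact: esym (isof _ _ _).
Qed.

Lemma speed_comp f (c : R -> M) t : isometric g f -> diff_at f (c t) -> curve_diff c t ->
  speed g (f \o c) t = speed g c t.
Proof.
move=> isof df dc; rewrite /speed (velocity_comp df dc).
exact: (congr1 Num.sqrt (isof (c t) (velocity c t) (velocity c t))).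
Qed.

Definition tangent_mx f p : 'M[R]_n := \matrix_(i < n) tangent_map f p (delta_mx 0 i).

Lemma tangent_mxE f p v : diff_at f p -> tangent_map f p v = v *m tangent_mx f p.
Proof.
move=> df; rewrite (tangent_map_linear df) mulmx_sum_row; apply: eq_bigr => c _.
by rewrite rowK.
Qed.

Lemma isometric_gram f p : isometric g f -> diff_at f p ->
  tangent_mx f p *m gram g (f p) *m (tangent_mx f p)^T = gram g p.
Proof.
move=> isof df; apply/matrixP => i j; rewrite -quadratic_entry !rowK.
apply: etrans (isof p (delta_mx 0 i) (delta_mx 0 j)) _.
by rewrite /inner -rowE trmx_delta -colE !mxE.
Qed.

Lemma gram_unit p : gram g p \in unitmx.
Proof. by apply: posdef_unitmx => v; exact: gram_posdef. Qed.

Lemma tangent_mx_unit f p : isometric g f -> diff_at f p -> tangent_mx f p \in unitmx.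
Proof.
move=> isof df; have := gram_unit p; rewrite -(isometric_gram isof df).
by rewrite !unitmx_mul => /andP[/andP[]].
Qed.

(** The image of the coordinate vectors under the differential of an isometry spans
    the tangent space. *)
Lemma isometric_nondegenerate f p u : isometric g f -> diff_at f p ->
  (forall i, inner g (f p) u (tangent_map f p (delta_mx 0 i)) = 0) -> u = 0.
Proof.
move=> isof df H; apply: (@inner_eq0 (f p)).
have -> : u = (u *m invmx (tangent_mx f p)) *m tangent_mx f p.
  by rewrite mulmxKV // tangent_mx_unit.
rewrite {2}[_ *m _ *m _]mulmx_sum_row inner_sum big1 // => i _.
by rewrite rowK mulmxKV ?tangent_mx_unit // H mulr0.
Qed.

End Metric.

(** * Conserved quantities of a group action by isometries *)

(** A family [act] of isometries parametrized by the group, with [act 1 = id] and with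
    orbit maps that are isometries as well.  It stands both for right translations
    [act a x = x * a] and for left translations [act a x = a * x]; as these differ by
    the order of the factors, the decomposition of the coordinates of a pair
    (parameter, point) into its components is kept abstract ([px], [py], [mk]). *)
Section Action.
Context {R : realType} {n : nat} {G : lieGroupType R n}.
Variable g : riemannian_metric G.
Variable act : G -> G -> G.
Hypothesis act1 : forall p, act 1%g p = p.
Hypothesis act_continuous : forall a p, {for (a, p), continuous (fun z : G * G => act z.1 z.2)}.
Hypothesis act_diff : forall a p, diff_at (act a) p.
Hypothesis act_isometric : forall a, isometric g (act a).
Hypothesis orbit_diff : forall a p, diff_at (act^~ p) a.
Hypothesis orbit_isometric : forall p, isometric g (act^~ p).
Variables (px py : 'rV[R]_(n + n) -> 'rV[R]_n) (mk : 'rV[R]_n -> 'rV[R]_n -> 'rV[R]_(n + n)).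
Variables (alpha beta : 'I_n -> 'I_(n + n)).
Hypothesis mkK : forall z, mk (py z) (px z) = z.
Hypothesis pxE : forall y x, px (mk y x) = x.
Hypothesis pyE : forall y x, py (mk y x) = y.
Hypothesis px_continuous : continuous px.
Hypothesis py_continuous : continuous py.
Hypothesis mkx : forall y x (s : R) i, mk y (s *: delta_mx 0 i + x) = s *: delta_mx 0 (alpha i) + mk y x.
Hypothesis mky : forall y x (s : R) i, mk (s *: delta_mx 0 i + y) x = s *: delta_mx 0 (beta i) + mk y x.
Hypothesis mk_diff : forall y x, differentiable (mk y) x.

Let act_chart q : 'rV[R]_(n + n) -> G :=
  fun z => act (chart_inv (chart_at (1%g : G)) (py z)) (chart_inv (chart_at q) (px z)).
Let F q := chart_at q \o act_chart q.
Let U q := [set z | [/\ chart_codom (chart_at q) (px z), chart_codom (chart_at (1%g : G)) (py z) &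
   in_chart q (act_chart q z)]].
Hypothesis act_smooth : forall q, smooth_on (U q) (F q).

Let y0 := chart_at (1%g : G) 1%g.
Let K q (l : 'I_n) : 'rV[R]_n -> 'rV[R]_n := fun x => partial (beta l) (F q) (mk y0 x).

Let one_chart : in_chart (1%g : G) 1%g. Proof. exact: in_chart_self. Qed.

Lemma act_near q p : in_chart q p -> \forall z \near mk y0 (chart_at q p), U q z.
Proof.
move=> qp; set z0 := mk _ _.
have cx : px z @[z --> z0] --> chart_at q p.
  by have := @px_continuous z0; rewrite /continuous_at pxE.
have cy : py z @[z --> z0] --> y0.
  by have := @py_continuous z0; rewrite /continuous_at pyE.
have c2 : act_chart q z @[z --> z0] --> p.
  have H1 : chart_inv (chart_at (1%g : G)) (py z) @[z --> z0] --> (1%g : G).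
    apply: (cvg_comp _ _ cy).
    have C : chart_inv (chart_at (1%g : G)) y @[y --> y0] -->
        chart_inv (chart_at (1%g : G)) y0 := chart_inv_cvg one_chart.
    by rewrite /y0 (chartK one_chart) in C.
  have H2 : chart_inv (chart_at q) (px z) @[z --> z0] --> p.
    apply: (cvg_comp _ _ cx).
    have C : chart_inv (chart_at q) x @[x --> chart_at q p] -->
        chart_inv (chart_at q) (chart_at q p) := chart_inv_cvg qp.
    by rewrite (chartK qp) in C.
  have C : (fun z : G * G => act z.1 z.2) z @[z --> (1%g, p)] --> act 1%g p.
    exact: act_continuous.
  rewrite act1 in C; exact: (cvg_comp _ _ (cvg_pair H1 H2) C).
near=> z; split.
- by near: z; apply: cx; exact: codom_near.
- by near: z; apply: cy; exact: codom_near.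
- by near: z; apply: c2; exact: in_chart_near.
Unshelve. all: by end_near. Qed.

Lemma F_row q y : F q \o mk y = local_rep q q (act (chart_inv (chart_at (1%g : G)) y)).
Proof. by apply/funext => x; rewrite /F /act_chart /local_rep /= pxE pyE. Qed.

Lemma F_col q x : F q \o mk^~ x = local_rep 1%g q (act^~ (chart_inv (chart_at q) x)).
Proof. by apply/funext => y; rewrite /F /act_chart /local_rep /= pxE pyE. Qed.

Lemma partial_F_row q p a i : in_chart q p ->
  partial (alpha i) (F q) (mk a (chart_at q p)) =
  local_derive q q (act (chart_inv (chart_at (1%g : G)) a)) p (delta_mx 0 i).
Proof.
move=> qp; rewrite /local_derive -F_row.
exact: esym (derive_affine (F q) (fun s => mkx a (chart_at q p) s i)).
Qed.

Lemma K_local_derive q p l : in_chart q p ->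
  K q l (chart_at q p) = local_derive 1%g q (act^~ p) 1%g (delta_mx 0 l).
Proof.
move=> qp; rewrite /local_derive -{2}(chartK qp) -F_col.
exact: esym (derive_affine (F q) (fun s => mky y0 (chart_at q p) s l)).
Qed.

Lemma act1_id : act 1%g = id. Proof. by apply/funext. Qed.

(** The field [K q l] is the velocity of [act] in the direction of the [l]-th coordinate
    vector at the identity, in the chart at [q]. *)
Lemma act_killing q p l : in_chart q p ->
  killing (local_gram (gram g) q) (K q l) (chart_at q p).
Proof.
move=> qp; have nU := act_near qp.
have z0U := nbhs_singleton nU.
apply: (killing_of_isometries (alpha := alpha) (pi := px)).
- by move=> x s i; rewrite mkx.
- by move=> z s; rewrite -[in LHS](mkK z) -mky pxE.
- by rewrite /F /act_chart /= pxE pyE /y0 !chartK // act1.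
- move=> i; rewrite partial_F_row // chartK // act1_id; exact: local_derive_id.
- by apply: filterS nU => z Uz; exact: (@act_smooth q [::] z Uz).
- by move=> i; exact: (@act_smooth q [:: alpha i] _ z0U).
- exact: (@act_smooth q [:: beta l] _ z0U).
- exact: local_gram_diff.
- apply: filterS nU => z [/chart_codomP[p' qp' Ex] _ Uz] i j.
  rewrite Ex -(mkK z) Ex.
  have qf : in_chart q (act (chart_inv (chart_at (1%g : G)) (py z)) p').
    by move: Uz; rewrite /act_chart Ex chartK.
  apply: (etrans (local_gram_isometric i j (act_isometric _) (act_diff _ _) qp' qf)).
  have -> : F q (mk (py z) (chart_at q p')) =
      chart_at q (act (chart_inv (chart_at (1%g : G)) (py z)) p').
    by rewrite /F /act_chart /= pxE pyE chartK.
  apply: eq_bigr => a _; apply: eq_bigr => b _.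
  by rewrite !partial_F_row.
Qed.

Lemma K_differentiable q p l : in_chart q p -> differentiable (K q l) (chart_at q p).
Proof.
move=> qp; have z0U := nbhs_singleton (act_near qp).
have dF : differentiable (partial (beta l) (F q)) (mk y0 (chart_at q p)).
  exact: (@act_smooth q [:: beta l] _ z0U).
exact: (differentiable_comp (mk_diff _ _) dF).
Qed.

(** The scalar product of the velocity with the [l]-th fundamental vector field of the
    action. *)
Definition noether_charge (c : R -> G) (l : 'I_n) (t : R) : R :=
  inner g (c t) (velocity c t) (tangent_map (act^~ (c t)) 1%g (delta_mx 0 l)).

Lemma momentum_inner q p v l : in_chart q p ->
  momentum (local_gram (gram g) q) (K q l) (chart_at q p) v =
  inner g p (local_derive q p id p v) (tangent_map (act^~ p) 1%g (delta_mx 0 l)).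
Proof.
move=> qp; have E : act^~ p 1%g = p := act1 p.
have qf : in_chart q (act^~ p 1%g) by rewrite E.
have := local_derive_tangent (delta_mx 0 l) (orbit_diff 1%g p) one_chart qf.
rewrite {1 2}E local_derive_id; last exact: one_chart.
move=> <-; rewrite -(K_local_derive l qp) (inner_chart _ _ _ qp).
by [].
Qed.

Lemma noether_charge_derive I c q l t : open I -> C2_on I c -> I t -> in_chart q (c t) ->
  is_derive t 1 (noether_charge c l)
   (inner g (c t) (local_derive q (c t) id (c t) (covariant_acceleration (local_gram (gram g) q) (chart_at q \o c) t))
      (tangent_map (act^~ (c t)) 1%g (delta_mx 0 l))).
Proof.
move=> oI C It qc; have [cc /(_ q qc)[dx ddx]] := C t It.
rewrite -momentum_inner //.
have := noether dx ddx (local_gram_diff g qc) (K_differentiable l qc) (local_gram_sym g qc)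
  (local_gram_unit g qc) (act_killing l qc).
apply: near_eq_is_derive.
have nI : \forall s \near t, I s by exact: open_nbhs_mem.
have nq : \forall s \near t, in_chart q (c s) by apply: cc; exact: in_chart_near.
apply: filterS2 nI nq => s Is qs.
have dc := C2_curve_diff C Is.
by rewrite /noether_charge (velocity_chart dc qs) -momentum_inner.
Qed.

(** Conservation of the charges says that the covariant acceleration is orthogonal to
    the fundamental fields, which span the tangent space because the orbit maps are
    isometries. *)
Lemma geodesicP I c : open I -> geodesic_on g I c <->
  C2_on I c /\ forall t l, I t -> is_derive t 1 (noether_charge c l) 0.
Proof.
move=> oI; split=> [H|[C H] t It].
  have C : C2_on I c.
    by move=> t It; have [cc Hq] := H t It; split => // q /Hq[].
  split => // t l It; have [cc /(_ (c t) (in_chart_self _)) [_ _ geo]] := H t It.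
  have := noether_charge_derive l oI C It (in_chart_self (c t)).
  set A := covariant_acceleration _ _ _.
  have -> : A = 0 by apply/rowP => k; rewrite !mxE; exact: geo.
  rewrite local_derive_id; last exact: in_chart_self.
  by rewrite /inner !mul0mx mxE.
have [cc Hq] := C t It; split => // q qc; have [dx ddx] := Hq q qc.
split => //.
set A := covariant_acceleration (local_gram (gram g) q) (chart_at q \o c) t.
suff A0 : A = 0.
  move=> k; have := congr1 (fun v : 'rV[R]_n => v 0 k) A0; rewrite !mxE; exact.
(* A tangent vector vanishes as soon as its coordinates in some chart do. *)
suff A0 : local_derive q (c t) id (c t) A = 0.
  rewrite -(local_derive_idK A qc (in_chart_self _)) A0.
  rewrite (local_derive_linear (local_diff_id (in_chart_self (c t)) qc)) big1 // => i _.
  by rewrite mxE scale0r.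
have := @isometric_nondegenerate _ _ _ g (act^~ (c t)) 1%g (local_derive q (c t) id (c t) A)
  (orbit_isometric _) (orbit_diff _ _).
rewrite act1; apply => l.
have D1 := noether_charge_derive l oI C It qc; have D2 := H t l It.
by rewrite -/A in D1; rewrite -(@derive_val _ _ _ _ _ _ _ D1) (@derive_val _ _ _ _ _ _ _ D2).
Qed.

End Action.

(** * Translations and inversion of a Lie group *)

Section Translations.
Context {R : realType} {n : nat} {G : lieGroupType R n}.
Implicit Types (a p q r : G).

Lemma row_mx_diffl (y x : 'rV[R]_n) : differentiable (fun x => row_mx x y) x.
Proof.
apply: differentiable_mx => i j; rewrite ord1.
case: (split_ordP j) => k ->.
  rewrite (_ : (fun x : 'rV_n => row_mx x y 0 (lshift n k)) = fun x : 'rV_n => x 0 k).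
    exact: differentiable_coord.
  by apply/funext => z; rewrite row_mxEl.
rewrite (_ : (fun x : 'rV_n => row_mx x y 0 (rshift n k)) = cst (y 0 k)).
  exact: differentiable_cst.
by apply/funext => z; rewrite row_mxEr.
Qed.

Lemma row_mx_diffr (y x : 'rV[R]_n) : differentiable (fun x => row_mx y x) x.
Proof.
apply: differentiable_mx => i j; rewrite ord1.
case: (split_ordP j) => k ->.
  rewrite (_ : (fun x : 'rV_n => row_mx y x 0 (lshift n k)) = cst (y 0 k)).
    exact: differentiable_cst.
  by apply/funext => z; rewrite row_mxEl.
rewrite (_ : (fun x : 'rV_n => row_mx y x 0 (rshift n k)) = fun x : 'rV_n => x 0 k).
  exact: differentiable_coord.
by apply/funext => z; rewrite row_mxEr.
Qed.

Definition mul_chart q1 q2 r : 'rV[R]_(n + n) -> 'rV[R]_n := fun z =>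
  chart_at r (chart_inv (chart_at q1) (lsubmx z) * chart_inv (chart_at q2) (rsubmx z))%g.

Lemma mul_chart_diff a p q1 q2 r : in_chart q1 a -> in_chart q2 p -> in_chart r (a * p)%g ->
  differentiable (mul_chart q1 q2 r) (row_mx (chart_at q1 a) (chart_at q2 p)).
Proof.
move=> qa qp rap.
apply: (@lie_mul_smooth R n G q1 q2 r [::] (row_mx (chart_at q1 a) (chart_at q2 p))).
by split; rewrite /= ?row_mxKl ?row_mxKr ?chartK //; exact: mem_codom.
Qed.

Lemma mulg_continuous_at a p : {for (a, p), continuous (fun z : G * G => (z.1 * z.2)%g)}.
Proof. exact: lie_mul_continuous. Qed.

Lemma mull_diff a p : diff_at (fun x : G => (a * x)%g) p.
Proof.
apply: (local_diff_at (in_chart_self p) (in_chart_self _)).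
  have C : (fun z : G * G => (z.1 * z.2)%g) z @[z --> (a, p)] --> (a * p)%g.
    exact: mulg_continuous_at.
  exact: (cvg_comp _ _ (cvg_pair (cvg_cst a) (@cvg_id _ (nbhs p))) C).
have E : local_rep p (a * p)%g (fun x => (a * x)%g) =
    mul_chart a p (a * p)%g \o (fun x => row_mx (chart_at a a) x).
  by apply/funext => x; rewrite /local_rep /mul_chart /= row_mxKl row_mxKr chartK //; exact: in_chart_self.
rewrite /local_diff E.
apply: differentiable_comp; first exact: row_mx_diffr.
apply: mul_chart_diff; exact: in_chart_self.
Qed.

Lemma mulr_diff a p : diff_at (fun x : G => (x * a)%g) p.
Proof.
apply: (local_diff_at (in_chart_self p) (in_chart_self _)).
  have C : (fun z : G * G => (z.1 * z.2)%g) z @[z --> (p, a)] --> (p * a)%g.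
    exact: mulg_continuous_at.
  exact: (cvg_comp _ _ (cvg_pair (@cvg_id _ (nbhs p)) (cvg_cst a)) C).
have E : local_rep p (p * a)%g (fun x => (x * a)%g) =
    mul_chart p a (p * a)%g \o (fun x => row_mx x (chart_at a a)).
  by apply/funext => x; rewrite /local_rep /mul_chart /= row_mxKl row_mxKr chartK //; exact: in_chart_self.
rewrite /local_diff E.
apply: differentiable_comp; first exact: row_mx_diffl.
apply: mul_chart_diff; exact: in_chart_self.
Qed.

Lemma inv_diff p : diff_at (fun x : G => x^-1%g) p.
Proof.
apply: (local_diff_at (in_chart_self p) (in_chart_self _)).
  exact: lie_inv_continuous.
apply: (@lie_inv_smooth R n G p p^-1%g [::] (chart_at p p)).
split; first exact: mem_codom (in_chart_self p).
by rewrite /= chartK; [exact: in_chart_self..].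
Qed.

(** The derivative of [x * x^-1 = 1], the partial derivatives of the multiplication at
    the pair (1, 1) being identities. *)
Lemma tangent_inv1 v : tangent_map (fun x : G => x^-1%g) 1%g v = - v.
Proof.
have i1 : in_chart (1%g : G) 1%g := in_chart_self 1%g.
pose y0 := chart_at (1%g : G) 1%g.
pose m := mul_chart 1%g 1%g 1%g.
have dm : differentiable m (row_mx y0 y0).
  by apply: mul_chart_diff => //; rewrite mulg1.
have dI : local_diff 1%g 1%g (fun x : G => x^-1%g) 1%g.
  by apply: (diff_at_local (inv_diff 1%g)) => //; rewrite invg1.
pose J := local_rep (1%g : G) 1%g (fun x : G => x^-1%g).
have J0 : J y0 = y0 by rewrite /J /y0 local_repE // invg1.
have -> : tangent_map (fun x : G => x^-1%g) 1%g v = 'D_v J y0.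
  by rewrite /tangent_map invg1.
set w := 'D_v J y0.
have near1 : \forall x \near y0, in_chart (1%g : G) ((chart_inv (chart_at (1%g : G)) x)^-1%g).
  apply: (near_chart_inv (P := fun y : G => in_chart (1%g : G) y^-1%g) i1).
  have : {for 1%g, continuous (fun x : G => x^-1%g)} by exact: lie_inv_continuous.
  by apply; rewrite invg1; exact: in_chart_near.
have dl : differentiable (fun x : 'rV_n => row_mx x (J x)) y0.
  apply: differentiable_mx => i j; rewrite ord1.
  case: (split_ordP j) => k ->.
    rewrite (_ : (fun x : 'rV_n => row_mx x (J x) 0 (lshift n k)) = fun x : 'rV_n => x 0 k).
      exact: differentiable_coord.
    by apply/funext => z; rewrite row_mxEl.
  rewrite (_ : (fun x : 'rV_n => row_mx x (J x) 0 (rshift n k)) = fun x : 'rV_n => J x 0 k).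
    exact: differentiable_entry.
  by apply/funext => z; rewrite row_mxEr.
have Dl : 'D_v (fun x : 'rV_n => row_mx x (J x)) y0 = row_mx v w.
  rewrite derive_mx; last exact: diff_derivable.
  apply/rowP => j; rewrite mxE.
  case: (split_ordP j) => k ->.
    rewrite row_mxEl (_ : (fun x : 'rV_n => row_mx x (J x) 0 (lshift n k)) = fun x : 'rV_n => x 0 k).
      have := derive_entry 0 k (@derivable_id _ _ y0 v); rewrite derive_id => E.
      exact: esym E.
    by apply/funext => z; rewrite row_mxEl.
  rewrite row_mxEr (_ : (fun x : 'rV_n => row_mx x (J x) 0 (rshift n k)) = fun x : 'rV_n => J x 0 k).
    exact: esym (derive_entry 0 k (diff_derivable (v := v) dI)).
  by apply/funext => z; rewrite row_mxEr.
have D0 : 'D_(row_mx v w) m (row_mx y0 y0) = 0.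
  have H : 'D_v (m \o (fun x : 'rV_n => row_mx x (J x))) y0 = 0.
    have E : \forall x \near y0, (m \o (fun x : 'rV_n => row_mx x (J x))) x = cst y0 x.
      apply: filterS near1 => x x1.
      by rewrite /m /mul_chart /= row_mxKl row_mxKr /J /local_rep /= chartK // mulgV.
    have E0 : 'D_v (m \o (fun x : 'rV_n => row_mx x (J x))) y0 = 'D_v (cst y0) y0.
      exact: near_eq_derive E.
    by rewrite E0 derive_cst.
  have dm' : differentiable m (row_mx y0 (J y0)) by rewrite J0.
  by rewrite -H (derive_comp v dl dm') Dl J0.
(* Multiplication restricts to the identity on each of the two factors. *)
have D1 u : 'D_(row_mx u 0) m (row_mx y0 y0) = u.
  have aff (s : R) : row_mx (s *: u + y0) y0 = s *: row_mx u 0 + row_mx y0 y0.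
    by rewrite scale_row_mx scaler0 add_row_mx add0r.
  rewrite -(derive_affine m (iota := fun x => row_mx x y0) aff).
  apply: etrans (@derive_id _ _ y0 u); apply: near_eq_derive.
  apply: filterS (codom_near i1) => x /chart_codomP[p' p1 ->].
  by rewrite /m /mul_chart /= row_mxKl row_mxKr !chartK // mulg1.
have D2 u : 'D_(row_mx 0 u) m (row_mx y0 y0) = u.
  have aff (s : R) : row_mx y0 (s *: u + y0) = s *: row_mx 0 u + row_mx y0 y0.
    by rewrite scale_row_mx scaler0 add_row_mx add0r.
  rewrite -(derive_affine m (iota := fun x => row_mx y0 x) aff).
  apply: etrans (@derive_id _ _ y0 u); apply: near_eq_derive.
  apply: filterS (codom_near i1) => x /chart_codomP[p' p1 ->].
  by rewrite /m /mul_chart /= row_mxKl row_mxKr !chartK // mul1g.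
have : 'D_(row_mx v w) m (row_mx y0 y0) = v + w.
  rewrite (deriveE _ dm) (_ : row_mx v w = row_mx v 0 + row_mx 0 w).
    by rewrite linearD /= -!(deriveE _ dm) D1 D2.
  by rewrite add_row_mx addr0 add0r.
by rewrite D0 => /esym/eqP; rewrite addrC addr_eq0 => /eqP.
Qed.

End Translations.

(** * Inversion maps geodesics to geodesics *)

Section SmoothMaps.
Context {R : realType} {n : nat} {M : manifoldType R n}.

Definition smooth_map (f : M -> M) := continuous f /\
  forall q r, smooth_on (chart_codom (chart_at q) `&`
    (f \o chart_inv (chart_at q)) @^-1` chart_dom (chart_at r)) (local_rep q r f).

Lemma smooth_map_local_rep (f : M -> M) p q r s : smooth_map f -> in_chart q p -> in_chart r (f p) ->
  differentiable (foldr partial (local_rep q r f) s) (chart_at q p).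
Proof.
move=> [_ sf] qp rf; apply: (sf q r s); split; first exact: mem_codom.
by rewrite /= chartK.
Qed.

Lemma smooth_map_diff (f : M -> M) p : smooth_map f -> diff_at f p.
Proof.
move=> sf; split; first exact: sf.1.
exact: (smooth_map_local_rep [::] sf (in_chart_self p) (in_chart_self (f p))).
Qed.

Lemma derive1_local_rep_curve (f : M -> M) (c : R -> M) t q r :
  smooth_map f -> {for t, continuous c} -> in_chart q (c t) -> in_chart r (f (c t)) ->
  (\forall s \near t, curve_diff c s) ->
  \forall s \near t, \sum_i (chart_at q \o c)^`()%classic s 0 i *: partial i (local_rep q r f) (chart_at q (c s))
     = (chart_at r \o (f \o c))^`()%classic s.
Proof.
move=> sf cc qc rf dc.
have nq : \forall s \near t, in_chart q (c s) by apply: cc; exact: in_chart_near.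
have nr : \forall s \near t, in_chart r (f (c s)).
  by apply: (continuous_comp cc (sf.1 (c t))); exact: in_chart_near.
apply: filterS (filterI dc (filterI nq nr)) => s [ds [qs rs]].
have df := smooth_map_diff (c s) sf.
have [_ E] := is_derive_local_rep_curve df ds qs rs.
rewrite [RHS]derive1E E; symmetry; exact: (local_derive_linear (diff_at_local df qs rs)).
Qed.

(** By the chain rule the derivative of the image curve is a sum of products of the
    coordinates of [x'] with the partial derivatives of the map along the curve, and
    these factors are again differentiable. *)
Lemma C2_on_comp (f : M -> M) (I : set R) (c : R -> M) :
  smooth_map f -> open I -> C2_on I c -> C2_on I (f \o c).
Proof.
move=> sf oI C t It; have [cc Hq] := C t It.
split; first exact: (continuous_comp cc (sf.1 (c t))).
move=> r rf.
have dc : \forall s \near t, curve_diff c s.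
  by apply: filterS (open_nbhs_mem oI It) => s Is; exact: (C2_curve_diff C Is).
have qc := in_chart_self (c t); have df := smooth_map_diff (c t) sf.
split; first by have [] := is_derive_local_rep_curve df (nbhs_singleton dc) qc rf.
apply: (near_eq_derivable (derive1_local_rep_curve sf cc qc rf dc)).
have [dx ddx] := Hq _ qc.
apply/derivable_mxP => i a.
set h := (fun s => _).
have -> : h = fun s => \sum_k ((chart_at (c t) \o c)^`()%classic s 0 k *
    partial k (local_rep (c t) r f) (chart_at (c t) (c s)) i a).
  by apply/funext => s; rewrite /h summxE; apply: eq_bigr => k _; rewrite mxE.
apply: (@ex_derive _ _ _ _ _ _ _ (is_derive_bigsum _)) => k.
apply: derivableP; apply: derivableM.
  exact: (proj1 (derivable_mxP _ _ _) ddx).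
have dp := differentiable_entry i a (smooth_map_local_rep [:: k] sf qc rf).
by have [] := is_derive_curve dp dx.
Qed.

Lemma C1_on_comp (f : M -> M) (I : set R) (c : R -> M) :
  smooth_map f -> open I -> C1_on I c -> C1_on I (f \o c).
Proof.
move=> sf oI C t It; have [cc Hq] := C t It.
split; first exact: (continuous_comp cc (sf.1 (c t))).
move=> r rf.
have dc : \forall s \near t, curve_diff c s.
  apply: filterS (open_nbhs_mem oI It) => s Is; split; first exact: (C s Is).1.
  by have [] := (C s Is).2 _ (in_chart_self _).
have qc := in_chart_self (c t); have df := smooth_map_diff (c t) sf.
split; first by have [] := is_derive_local_rep_curve df (nbhs_singleton dc) qc rf.
have E := derive1_local_rep_curve sf cc qc rf dc.
have [dx cdx] := Hq _ qc.
rewrite /prop_for /continuous_at -(nbhs_singleton E).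
apply: cvg_trans (near_eq_cvg E) _.
apply: (cvg_big (@add_continuous _)) => k _; apply: cvgZ.
  have := cvg_comp _ _ cdx (@coord_continuous _ _ _ 0 k _); exact.
have dp := smooth_map_local_rep [:: k] sf qc rf.
have cx : (chart_at (c t) \o c) s @[s --> t] --> (chart_at (c t) \o c) t.
  exact: (continuous_comp cc (chart_continuous qc)).
exact: (cvg_comp _ _ cx (differentiable_continuous dp)).
Qed.

End SmoothMaps.

Section Inversion.
Context {R : realType} {n : nat} {G : lieGroupType R n}.
Variable g : riemannian_metric G.
Hypothesis gbi : bi_invariant g.

Local Notation inv := (fun x : G => x^-1%g).

Lemma inv_smooth : smooth_map inv.
Proof.
split; first exact: lie_inv_continuous.
by move=> q r s x [qx rx]; exact: (@lie_inv_smooth R n G q r s x).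
Qed.

Lemma inner_opp p u v : inner g p (- u) (- v) = inner g p u v.
Proof. by rewrite /inner linearN /= mulNmx mulmxN mulNmx opprK. Qed.

Lemma inner_oppr p u v : inner g p u (- v) = - inner g p u v.
Proof. by rewrite /inner linearN /= mulmxN mxE. Qed.

Lemma tangent_map_opp f p v : diff_at (M := G) f p -> tangent_map f p (- v) = - tangent_map f p v.
Proof. by move=> df; rewrite !(tangent_mxE _ df) mulNmx. Qed.

(** This exhibits the differential of inversion at [p] as the differentials of two
    translations composed with that of inversion at 1. *)
Lemma inv_factor p : inv = (fun x => (p^-1 * x)%g) \o (inv \o (fun x => (x * p^-1)%g)).
Proof. by apply/funext => x /=; rewrite invgM invgK mulgA mulVg mul1g. Qed.

Lemma inv_isometric : isometric g inv.
Proof.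
move=> p u v.
have E w : tangent_map inv p w =
    - tangent_map (fun x : G => (p^-1 * x)%g) 1%g (tangent_map (fun x : G => (x * p^-1)%g) p w).
  rewrite {1}(inv_factor p).
  have d1 := mulr_diff p^-1%g p.
  have d2 := inv_diff (p * p^-1)%g.
  have d3 := mull_diff p^-1%g ((p * p^-1)^-1)%g.
  apply: etrans (tangent_map_comp w (diff_at_comp d1 d2) d3) _.
  rewrite (tangent_map_comp w d1 d2) /= mulgV invg1 tangent_inv1.
  exact: (tangent_map_opp _ (mull_diff p^-1%g 1%g)).
rewrite !E inner_opp.
have := (gbi p^-1%g).1 1%g (tangent_map (fun x : G => (x * p^-1)%g) p u)
  (tangent_map (fun x : G => (x * p^-1)%g) p v).
rewrite mulg1 => ->.
have := (gbi p^-1%g).2 p u v; by rewrite mulgV.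
Qed.

(** Right translations generate the left-invariant fields. *)
Definition chargeL := noether_charge g (fun a x : G => (x * a)%g).
Definition chargeR := noether_charge g (fun a x : G => (a * x)%g).

Lemma geodesic_chargeL I c : open I -> geodesic_on g I c <->
  C2_on I c /\ forall t l, I t -> is_derive t 1 (chargeL c l) 0.
Proof.
apply: (@geodesicP _ _ _ g (fun a x : G => (x * a)%g) _ _ _ _ _ _ lsubmx rsubmx
  (fun y x => row_mx x y) (lshift n) (@rshift n n)).
- exact: mulg1.
- move=> a p; apply: (@continuous_comp _ _ _ (fun z : G * G => (z.2, z.1)) (fun z : G * G => (z.1 * z.2)%g)).
    exact: (cvg_pair (@cvg_snd _ _ _ _ _) (@cvg_fst _ _ _ _ _)).
  exact: mulg_continuous_at.
- exact: mulr_diff.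
- by move=> a; exact: (gbi a).2.
- by move=> a p; exact: mull_diff.
- by move=> p; exact: (gbi p).1.
- exact: hsubmxK.
- by move=> y x; rewrite row_mxKl.
- by move=> y x; rewrite row_mxKr.
- by move=> z; apply: differentiable_continuous; exact: differentiable_lsubmx.
- by move=> z; apply: differentiable_continuous; exact: differentiable_rsubmx.
- by move=> y x s i; rewrite delta_mx_lshift scale_row_mx scaler0 add_row_mx add0r.
- by move=> y x s i; rewrite delta_mx_rshift scale_row_mx scaler0 add_row_mx add0r.
- by move=> y x; exact: row_mx_diffl.
- move=> q s z [h1 h2 h3]; exact: (@lie_mul_smooth R n G q 1%g q s z).
Qed.

Lemma geodesic_chargeR I c : open I -> geodesic_on g I c <->
  C2_on I c /\ forall t l, I t -> is_derive t 1 (chargeR c l) 0.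
Proof.
apply: (@geodesicP _ _ _ g (fun a x : G => (a * x)%g) _ _ _ _ _ _ rsubmx lsubmx
  (fun y x => row_mx y x) (@rshift n n) (lshift n)).
- exact: mul1g.
- exact: mulg_continuous_at.
- exact: mull_diff.
- by move=> a; exact: (gbi a).1.
- by move=> a p; exact: mulr_diff.
- by move=> p; exact: (gbi p).2.
- exact: hsubmxK.
- by move=> y x; rewrite row_mxKr.
- by move=> y x; rewrite row_mxKl.
- by move=> z; apply: differentiable_continuous; exact: differentiable_rsubmx.
- by move=> z; apply: differentiable_continuous; exact: differentiable_lsubmx.
- by move=> y x s i; rewrite delta_mx_rshift scale_row_mx scaler0 add_row_mx add0r.
- by move=> y x s i; rewrite delta_mx_lshift scale_row_mx scaler0 add_row_mx add0r.
- by move=> y x; exact: row_mx_diffr.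
- move=> q s z [h1 h2 h3]; exact: (@lie_mul_smooth R n G 1%g q q s z).
Qed.

(** Inversion exchanges left and right translations, [(y * p)^-1 = p^-1 * y^-1], and
    acts as [- 1] on the tangent space at 1; moreover it is an isometry. *)
Lemma chargeL_inv (c : R -> G) l t : curve_diff c t ->
  chargeL (inv \o c) l t = - chargeR c l t.
Proof.
move=> dc; rewrite /chargeL /chargeR /noether_charge.
rewrite (velocity_comp (inv_diff (c t)) dc).
rewrite /=; set p := c t.
have E v : tangent_map (fun y : G => (p^-1 * y)%g) 1%g (- v) =
    tangent_map inv p (tangent_map (fun y : G => (y * p)%g) 1%g v).
  have d1 := mulr_diff p 1%g; have d2 := inv_diff (1 * p)%g.
  have d3 := inv_diff (1%g : G); have d4 := mull_diff p^-1%g (1^-1)%g.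
  have := tangent_map_comp v d1 d2; rewrite [in X in X -> _]mul1g => <-.
  have -> : inv \o (fun x => (x * p)%g) = (fun x => (p^-1 * x)%g) \o inv.
    by apply/funext => x /=; rewrite invgM.
  by rewrite (tangent_map_comp v d3 d4) /= invg1 tangent_inv1.
rewrite -[delta_mx 0 l in LHS]opprK E.
rewrite -(inv_isometric p) -inner_oppr; congr (inner _ _ _ _).
rewrite -tangent_map_opp; last exact: inv_diff.
congr (tangent_map _ _ _); exact: (tangent_map_opp _ (mulr_diff p 1%g)).
Qed.

Lemma inv_geodesic I c : open I -> geodesic_on g I c -> geodesic_on g I (inv \o c).
Proof.
move=> oI geo; have [C HR] := (geodesic_chargeR c oI).1 geo.
apply/(geodesic_chargeL _ oI); split; first exact: (C2_on_comp inv_smooth oI C).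
move=> t l It.
have := is_deriveN (HR t l It); rewrite oppr0.
apply: near_eq_is_derive; apply: filterS (open_nbhs_mem oI It) => s Is.
by rewrite chargeL_inv //; exact: (C2_curve_diff C Is).
Qed.

End Inversion.

(** * Lebesgue integrals of arbitrary functions *)

Section Lebesgue.
Context {d : measure_display} {T : measurableType d} {R : realType}.
Variable mu : {measure set T -> \bar R}.
Import HBSimple HBNNSimple.
Local Open Scope ereal_scope.

(** The integral of a nonnegative function, by definition; it makes sense for arbitrary
    functions. *)
Definition lower_integral (f : T -> \bar R) : \bar R :=
  ereal_sup [set sintegral mu h | h in [set h : {nnsfun T >-> R} | forall x, (h x)%:E <= f x]].

Lemma integral_lower (D : set T) (f : T -> \bar R) :
  \int[mu]_(x in D) f x = lower_integral ((f \_ D) ^\+) - lower_integral ((f \_ D) ^\-).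
Proof. by []. Qed.

Lemma lower_integral_ge0 f : (forall x, 0 <= f x) -> 0 <= lower_integral f.
Proof.
by move=> f0; apply: ereal_sup_ubound; exists nnsfun0 => //; exact: sintegral0.
Qed.

(** If both terms are infinite, then both sides are 0 because [fine] sends infinities
    to 0. *)
Lemma fine_subC (a b : \bar R) : 0 <= a -> 0 <= b -> fine (a - b) = (- fine (b - a))%R.
Proof. by move: a b => [a| |] [b| |] //= _ _; rewrite ?oppr0 // opprB. Qed.

Lemma RintegralN_nonmeasurable (D : set T) (f : T -> R) :
  Rintegral mu D (fun x => - f x)%R = (- Rintegral mu D f)%R.
Proof.
rewrite /Rintegral !integral_lower.
set F := (fun x => (f x)%:E) \_ D.
have p0 : 0 <= lower_integral F^\+ by apply: lower_integral_ge0 => x; exact: funepos_ge0.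
have n0 : 0 <= lower_integral F^\- by apply: lower_integral_ge0 => x; exact: funeneg_ge0.
rewrite -(fine_subC n0 p0).
have E : (fun x => (- f x)%:E) \_ D = -%E \o F.
  by apply/funext => x; rewrite /F /= !patchE; case: ifPn => // _; rewrite oppe0.
rewrite E; congr (fine (_ - _)); congr lower_integral.
  by rewrite -funeposN; congr funepos.
by rewrite -funenegN; congr funeneg; apply/funext => x /=; rewrite oppeK.
Qed.

Lemma sintegral_off_null (N : set T) (h : {nnsfun T >-> R}) : measurable N -> mu N = 0 ->
  exists2 h' : {nnsfun T >-> R}, sintegral mu h' = sintegral mu h &
    forall x, h' x = if x \in N then 0%R else h x.
Proof.
move=> mN N0; have mNC : measurable (~` N) by exact: measurableC.
have hE x : proj_nnsfun h mNC x = if x \in N then 0%R else h x.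
  by rewrite -mrestrict patchE in_setC; case: (x \in N).
exists (proj_nnsfun h mNC) => //.
rewrite -!integralT_nnsfun; apply: ae_eq_integral.
- exact: measurableT.
- by apply/measurable_EFinP; exact: measurable_funPT.
- by apply/measurable_EFinP; exact: measurable_funPT.
exists N; split => // x; apply: contra_notP => Nx _.
by rewrite hE memNset.
Qed.

(** A simple function below [f] can be set to 0 on the null set without changing its
    integral, and is then below [g]. *)
Lemma lower_integral_off_null (N : set T) (f g : T -> \bar R) :
  measurable N -> mu N = 0 -> (forall x, 0 <= g x) ->
  (forall x, ~ N x -> f x = g x) -> lower_integral f <= lower_integral g.
Proof.
move=> mN N0 g0 fg; apply: ub_ereal_sup => _ [h hf <-].
have [h' <- h'E] := sintegral_off_null h mN N0.
apply: ereal_sup_ubound; exists h' => // x /=; rewrite h'E.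
case: ifPn => [_|]; first exact: g0.
by move=> /negP; rewrite inE => Nx; rewrite -fg.
Qed.

Lemma integral_off_null (D N : set T) (f g : T -> \bar R) :
  measurable N -> mu N = 0 -> (forall x, D x -> ~ N x -> f x = g x) ->
  \int[mu]_(x in D) f x = \int[mu]_(x in D) g x.
Proof.
move=> mN N0 fg; rewrite !integral_lower.
have E x : ~ N x -> (f \_ D) x = (g \_ D) x.
  by move=> Nx; rewrite !patchE; case: ifPn => // /set_mem Dx; exact: fg.
have Ep x : ~ N x -> (f \_ D)^\+ x = (g \_ D)^\+ x by move=> /E; rewrite !funeposE => ->.
have En x : ~ N x -> (f \_ D)^\- x = (g \_ D)^\- x by move=> /E; rewrite !funenegE => ->.
congr (_ - _); apply/eqP; rewrite eq_le; apply/andP; split;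
  apply: (lower_integral_off_null mN N0) => x;
  by [exact: funepos_ge0|exact: funeneg_ge0|exact: Ep|exact: En|move=> /Ep|move=> /En].
Qed.

Section Involution.
Variable r : T -> T.
Hypothesis mr : measurable_fun setT r.
Hypothesis rK : involutive r.
Hypothesis mur : forall A, measurable A -> mu (r @^-1` A) = mu A.

Lemma sintegral_involution (h : {nnsfun T >-> R}) :
  exists2 h' : {nnsfun T >-> R}, sintegral mu h' = sintegral mu h & forall x, h' x = h (r x).
Proof.
have mh : measurable_fun setT (h \o r) by exact: measurableT_comp.
have fh : finite_set (range (h \o r)).
  apply: (sub_finite_set _ (fimfunP h)) => _ [x _ <-]; by exists (r x).
have ph x : (0 <= (h \o r) x)%R by exact: fun_ge0.
pose m1 := isMeasurableFun.Build _ _ _ _ (h \o r) mh.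
pose m2 := FiniteImage.Build _ _ (h \o r) fh.
pose m3 := isNonNegFun.Build _ _ (h \o r) ph.
pose h' : {nnsfun T >-> R} := HB.pack (h \o r) m1 m2 m3.
exists h' => //.
rewrite /sintegral; apply: eq_fsbigr => x _; congr (_ * _).
rewrite -(mur (measurable_sfunP h (measurable_set1 x))).
by [].
Qed.

Lemma lower_integral_involution (f : T -> \bar R) : lower_integral (f \o r) = lower_integral f.
Proof.
have H u : lower_integral u <= lower_integral (u \o r).
  apply: ub_ereal_sup => _ [h hu <-]; have [h' <- h'E] := sintegral_involution h.
  by apply: ereal_sup_ubound; exists h' => // x /=; rewrite h'E.
apply/eqP; rewrite eq_le H andbT; apply: le_trans (H _) _.
by rewrite (_ : (f \o r) \o r = f) //; apply/funext => x /=; rewrite rK.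
Qed.

(** Composition with the involution permutes the simple functions below [f] and those
    below [f \o r]. *)
Lemma Rintegral_involution (D : set T) (f : T -> R) :
  (forall x, D x -> D (r x)) -> Rintegral mu D (f \o r) = Rintegral mu D f.
Proof.
move=> Dr; rewrite /Rintegral !integral_lower.
have E : (fun x => ((f \o r) x)%:E) \_ D = ((fun x => (f x)%:E) \_ D) \o r.
  apply/funext => x; rewrite /= !patchE.
  have -> : (r x \in D) = (x \in D) by apply/idP/idP; rewrite !inE => /Dr //; rewrite rK.
  by [].
by rewrite E funepos_comp funeneg_comp !lower_integral_involution.
Qed.

Lemma Rintegral_odd (D : set T) (f : T -> R) :
  (forall x, D x -> D (r x)) -> (forall x, D x -> f (r x) = - f x)%R ->
  Rintegral mu D f = 0%R.
Proof.
move=> Dr fr.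
have : Rintegral mu D f = (- Rintegral mu D f)%R.
  rewrite -RintegralN_nonmeasurable -[LHS](Rintegral_involution f Dr).
  by apply: eq_Rintegral => x; rewrite inE => /fr.
by move/eqP; rewrite -subr_eq0 opprK -mulr2n mulrn_eq0 /= => /eqP.
Qed.

End Involution.
End Lebesgue.

(** * Haar measure and inversion *)

Section Haar.
Context {R : realType} {n : nat} {G : lieGroupType R n}.
Local Notation BG := (borel G).
Local Open Scope ereal_scope.

Lemma borel_open (U : set BG) : @open (pointed_group G) U -> measurable U.
Proof. by move=> oU; exact: sub_sigma_algebra. Qed.

(** Second countability is essential here: it writes an open set as a countable union
    of rectangles, so that continuous maps on the product are measurable for the
    product of the Borel sigma-algebras. *)
Lemma open_prod_measurable (W : set (BG * BG)) :
  @open (G * G)%type W -> measurable W.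
Proof.
move=> oW; have [B cB [Bo Bb]] := @manifold_second_countable R n G.
pose P := [set uv : set G * set G | [/\ B uv.1, B uv.2 & uv.1 `*` uv.2 `<=` W]].
have cP : countable P.
  by apply: (sub_countable (subset_card_le _) (countableX cB cB)) => -[u v] [].
have -> : W = \bigcup_(uv in P) (uv.1 `*` uv.2).
  apply/seteqP; split => [[x y] Wxy|z [uv [_ _ s] /s]//].
  have : nbhs ((x, y) : G * G) W by exact: open_nbhs_nbhs.
  move=> [[A1 A2] /= [nA1 nA2] sA].
  have [u [Bu ux] uA] := Bb x _ nA1; have [v [Bv vy] vA] := Bb y _ nA2.
  exists (u, v) => //; split => // -[a b] [/= ua vb]; apply: sA; split; [exact: uA|exact: vA].
have mP uv : P uv -> measurable ((uv.1 : set BG) `*` (uv.2 : set BG)).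
  by move=> [B1 B2 _]; apply: measurableX; apply: borel_open; exact: Bo.
have /pfcard_geP[P0|[f]] := cP; first by rewrite P0 bigcup_set0; exact: measurable0.
have -> : \bigcup_(uv in P) (uv.1 `*` uv.2) = \bigcup_k ((f k).1 `*` (f k).2).
  apply/seteqP; split => [z [uv Puv zuv]|z [k _ zk]].
    have [k _ fk] := @surj _ _ _ _ f uv Puv.
    by exists k => //; rewrite fk.
  by exists (f k) => //; exact: (@funS _ _ _ _ f k).
apply: bigcupT_measurable => k; apply: mP; exact: (@funS _ _ _ _ f k).
Qed.

Lemma borel_measurable_continuous (f : G * G -> G) : continuous f ->
  measurable_fun setT (f : BG * BG -> BG).
Proof.
move=> cf; apply: (@measurability _ _ (BG * BG)%type BG setT f (@open (pointed_group G)) erefl).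
move=> _ [U oU <-]; rewrite setTI; apply: open_prod_measurable.
exact: (open_comp (fun z _ => cf z) oU).
Qed.

Lemma inv_borel_measurable : measurable_fun setT ((fun x : G => x^-1%g) : BG -> BG).
Proof.
apply: (@measurability _ _ BG BG setT _ (@open (pointed_group G)) erefl).
move=> _ [U oU <-]; rewrite setTI; apply: borel_open.
exact: (open_comp (fun z _ => @lie_inv_continuous R n G z) oU).
Qed.

(** The set [{(x, y) | x^-1 y \in A}] has sections [x A] and [y A^-1], of constant measures
    [mu A] and [mu A^-1] by left invariance, and Fubini's theorem compares the two. *)
Lemma haar_inv (mu : {measure set BG -> \bar R}) (A : set BG) :
  compact [set: G] -> haar_measure mu -> measurable A ->
  mu ((fun x : G => x^-1%g) @^-1` A) = mu A.
Proof.
move=> cG [inv_mu mu0 mu_fin _ _] mA.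
have muT : mu setT < +oo by exact: mu_fin.
have fin_mu : fin_num_fun mu.
  move=> U mU; rewrite ge0_fin_numE //; apply: le_lt_trans muT.
  by apply: le_measure; rewrite ?inE //; exact: measurableT.
pose H1 := isFinite.Build _ _ _ _ fin_mu.
have sfin : sigma_finite setT mu.
  by apply: fin_num_fun_sigma_finite => //; rewrite measure0.
pose H2 := isSFinite.Build _ _ _ _ (sfinite_measure_sigma_finite sfin).
pose H3 := isSigmaFinite.Build _ _ _ _ sfin.
(* [nu] is [mu] together with its finiteness, as Fubini's theorem requires. *)
pose nu := HB.pack_for (FiniteMeasure.type BG R) (Measure.sort mu) H1 H2 H3.
pose E : set (BG * BG) := (fun z : G * G => (z.1^-1 * z.2)%g) @^-1` A.
have mE : measurable E.
  rewrite /E -[X in measurable X]setTI; apply: borel_measurable_continuous => // z.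
  have C := @lie_mul_continuous R n G ((z.1^-1)%g, z.2).
  have C1 : (w.1^-1)%g @[w --> z] --> (z.1^-1)%g.
    apply: (@continuous_comp _ _ _ fst (fun x : G => x^-1%g)); first exact: cvg_fst.
    exact: lie_inv_continuous.
  have C2 : w.2 @[w --> z] --> z.2 by exact: cvg_snd.
  exact: (cvg_comp _ _ (cvg_pair C1 C2) C).
have := indic_fubini_tonelli nu nu mE.
rewrite indic_fubini_tonelli_FE // indic_fubini_tonelli_GE //.
pose Ai : set BG := (fun x : G => x^-1%g) @^-1` A; rewrite -/Ai.
have mAi : measurable Ai by rewrite /Ai -[X in measurable X]setTI; exact: inv_borel_measurable.
have -> : nu \o xsection E = cst (mu A).
  apply/funext => x /=; rewrite -(inv_mu x A mA); congr (mu _).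
  apply/seteqP; split => [y /=|_ [y Ay <-]].
    by rewrite /xsection /= inE /E /= => Ay; exists (x^-1 * y)%g => //; rewrite mulVKg.
  by rewrite /xsection /= inE /E /= mulKg.
have -> : nu \o ysection E = cst (mu Ai).
  apply/funext => y /=; rewrite -(inv_mu y Ai mAi); congr (mu _).
  apply/seteqP; split => [x /=|_ [x Ax <-]].
    rewrite /ysection /= inE /E /= => Ax; exists (y^-1 * x)%g => //; last by rewrite mulVKg.
    by rewrite /Ai /= invgM invgK.
  by rewrite /ysection /= inE /E /= invgM mulgVK.
rewrite !integral_cst //= => H.
have fT := fin_mu setT measurableT.
have H' : (fine (mu setT) != 0)%R.
  by apply: contra mu0 => /eqP z0; rewrite -(fineK fT) z0.
have H'' : mu A * mu setT = mu Ai * mu setT by exact: H.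
rewrite -(fineK (fin_mu A mA)) -(fineK (fin_mu Ai mAi)).
move: H''; rewrite -(fineK (fin_mu A mA)) -(fineK (fin_mu Ai mAi)) -(fineK fT) -!EFinM.
by case=> /(mulIf H') ->.
Qed.

End Haar.

(** * Lengths, minimizing geodesics and the cut locus *)

Section LocalCurves.
Context {R : realType} {n : nat} {M : manifoldType R n}.
Implicit Types c : R -> M.

Lemma curve_diff_near c c' t : {near t, c =1 c'} -> curve_diff c t -> curve_diff c' t.
Proof.
move=> E [cc dc]; have e := nbhs_singleton E; split.
  by rewrite /prop_for /continuous_at -e; apply: cvg_trans (near_eq_cvg E) _; exact: cc.
rewrite -e; apply: near_eq_derivable dc.
by apply: filterS E => s /= ->.
Qed.

Lemma velocity_near c c' t : {near t, c =1 c'} -> velocity c t = velocity c' t.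
Proof.
move=> E; rewrite /velocity -(nbhs_singleton E) !derive1E; apply: near_eq_derive.
by apply: filterS E => s /= ->.
Qed.

Lemma near_itvoo (a b t : R) : a < t < b -> \forall s \near t, s \in `]a, b[.
Proof.
move=> tab; apply: near_in_itvoo; by rewrite in_itv.
Qed.

Lemma itv_partition_piece (a t : R) (s : seq R) : path <%R a s -> a < t -> t < last a s ->
  t \notin s -> exists2 i, (i < size s)%N & (a :: s)`_i < t < s`_i.
Proof.
elim: s a => [|b s IH] a /=; first by move=> _ h1 h2; have := lt_trans h1 h2; rewrite ltxx.
move=> /andP[ab pb] at' tl; rewrite inE negb_or => /andP[tb ts].
have [tb'|bt|tb'] := ltgtP t b; first by exists 0%N => //=; rewrite at' tb'.
  by have [i ilt H] := IH b pb bt tl ts; exists i.+1.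
by rewrite tb' eqxx in tb.
Qed.

Lemma piecewise_C1_diff c : piecewise_C1 c -> exists s : seq R,
  forall t, 0 <= t <= 1 -> t \notin s -> curve_diff c t.
Proof.
move=> [_ [s [ps /eqP ls] H]]; exists (0 :: s) => t /andP[t0 t1].
rewrite inE negb_or => /andP[tn0 ts].
(* The end point 1 is itself a node, so that [t] is in the open interval. *)
have l1 : 1 \in s.
  case: s ps ls H ts => [|b s] /= _; first by move/eqP; rewrite eq_sym oner_eq0.
  by move=> <- _ _; exact: mem_last.
have {}t0 : 0 < t by rewrite lt_neqAle eq_sym tn0.
have {}t1 : t < last 0 s.
  by rewrite ls lt_neqAle t1 andbT; apply: contra ts => /eqP ->.
have [i si /andP[it ti]] := itv_partition_piece ps t0 t1 ts.
have [d [c' [d0 C cc']]] := H i si.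
have tI : `](0 :: s)`_i - d, s`_i + d[%classic t.
  by rewrite /= in_itv /=; apply/andP; split; lra.
apply: (curve_diff_near (c := c')).
  have /near_itvoo : (0 :: s)`_i < t < s`_i by rewrite it ti.
  by apply: filterS => u uI; apply: cc'; exact: subset_itv_oo_cc uI.
split; first exact: (C t tI).1.
by have [] := (C t tI).2 _ (in_chart_self _).
Qed.

Lemma piecewise_C1_comp (f : M -> M) c : smooth_map f -> piecewise_C1 c -> piecewise_C1 (f \o c).
Proof.
move=> sf [cc [s ps H]]; split.
  by move=> x; apply: (continuous_comp (cc x)); exact: sf.1.
exists s => // i si; have [d [c' [d0 C cc']]] := H i si.
exists d, (f \o c'); split => //.
- by apply: C1_on_comp => //; exact: itv_open.
- by move=> t tI /=; rewrite cc'.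
Qed.

(** The speeds agree except perhaps at the finitely many nodes, where the velocity of
    a broken path has no meaning. *)
Lemma path_length_comp (g : riemannian_metric M) (f : M -> M) c :
  smooth_map f -> isometric g f -> piecewise_C1 c -> path_length g (f \o c) = path_length g c.
Proof.
move=> sf isof /piecewise_C1_diff[s Hs].
apply: (congr1 fine).
have cs : countable [set` s] by exact: finite_set_countable (finite_seq s).
apply: (@integral_off_null _ _ _ lebesgue_measure _ [set` s]).
- by apply: countable_measurable => // t; exact: measurable_set1.
- exact: countable_lebesgue_measure0.
move=> t /=; rewrite in_itv /= => t01 /negP ts; apply: (congr1 EFin).
have dc := Hs t t01 ts.
exact: (speed_comp isof (smooth_map_diff _ sf) dc).
Qed.

End LocalCurves.

Section Isometry.
Context {R : realType} {n : nat} {G : lieGroupType R n}.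
Variable g : riemannian_metric G.
Hypothesis gbi : bi_invariant g.
Local Notation inv := (fun x : G => x^-1%g).

Lemma path_between_inv (p q : G) c : path_between p q c ->
  path_between p^-1%g q^-1%g (inv \o c).
Proof.
by move=> [pc <- <-]; split => //; exact: (piecewise_C1_comp inv_smooth pc).
Qed.

Lemma path_length_inv (c : R -> G) : piecewise_C1 c ->
  path_length g (inv \o c) = path_length g c.
Proof. exact: (path_length_comp inv_smooth (inv_isometric gbi)). Qed.

Lemma dist_inv (p q : G) : dist g p^-1%g q^-1%g = dist g p q.
Proof.
rewrite /dist; congr inf; apply/seteqP; split => [_ [c pc <-]|_ [c pc <-]].
  exists (inv \o c); first by have := path_between_inv pc; rewrite !invgK.
  by apply: path_length_inv; case: pc.
exists (inv \o c); first exact: path_between_inv.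
by apply: path_length_inv; case: pc.
Qed.

Lemma geodesic_curve_diff I (c : R -> G) t : geodesic_on g I c -> I t -> curve_diff c t.
Proof.
move=> geo It; have [cc /(_ (c t) (in_chart_self _)) [dx _ _]] := geo t It.
by split.
Qed.

Lemma speed_inv (c : R -> G) t : curve_diff c t -> speed g (inv \o c) t = speed g c t.
Proof. exact: (speed_comp (inv_isometric gbi) (inv_diff (c t))). Qed.

Lemma minimizing_geodesic_inv (p q : G) c : minimizing_geodesic g p q c ->
  minimizing_geodesic g p^-1%g q^-1%g (inv \o c).
Proof.
move=> [[d d0 geo] [v sv] pc mc]; split.
- by exists d; [exact: d0|exact: (inv_geodesic gbi (itv_open _ _) geo)].
- exists v => t t01; rewrite -(sv t t01); apply/speed_inv/(geodesic_curve_diff geo).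
  move: t01; rewrite /= !in_itv /= => /andP[t0 t1].
  by apply/andP; split; lra.
- exact: path_between_inv.
- move=> c' pc'; have H := path_between_inv pc'.
  rewrite path_length_inv; last by case: pc.
  rewrite !invgK in H; apply: le_trans (mc _ H) _.
  by rewrite path_length_inv //; case: pc'.
Qed.

Lemma unique_minimizing_geodesic_inv (q : G) c : unique_minimizing_geodesic g 1%g q c ->
  unique_minimizing_geodesic g 1%g q^-1%g (inv \o c).
Proof.
move=> [mc uc]; split; first by have := minimizing_geodesic_inv mc; rewrite invg1.
move=> c' mc'; have := minimizing_geodesic_inv mc'; rewrite invg1 invgK => /uc H t t01 /=.
by rewrite -(H t t01) /= invgK.
Qed.

Lemma cut_locus_inv (q : G) : cut_locus g 1%g q -> cut_locus g 1%g q^-1%g.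
Proof.
move=> [c [t0 [geo sc c0 t0_gt0 [Hd <-]]]].
exists (inv \o c), t0; split.
- exact: (inv_geodesic gbi openT geo).
- by move=> t; rewrite (speed_inv (geodesic_curve_diff geo (I : setT t))) sc.
- by rewrite /= c0 invg1.
- exact: t0_gt0.
- split => // t t_ge0; rewrite -(Hd t t_ge0).
  by rewrite -[X in dist _ X _]invg1 dist_inv.
Qed.

Lemma const_on_itv (d : R) (q : R -> R) u : 0 < d ->
  (forall t, `]- d, 1 + d[%classic t -> is_derive t 1 q 0) -> 0 <= u <= 1 -> q u = q 0.
Proof.
move=> d0 H /andP[u0 u1].
have I t : t \in `[0, u] -> `]- d, 1 + d[%classic t.
  by rewrite /= !in_itv /= => /andP[t0 t1]; apply/andP; split; lra.
have dq t : t \in `]0, u[ -> is_derive t 1 q 0.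
  by move=> tu; apply: H; apply: I; exact: subset_itv_oo_cc tu.
have cq : {within `[0, u], continuous q}.
  by apply: derivable_within_continuous => t tu; have [] := H t (I t tu).
have [v _] := MVT_segment u0 dq cq.
by rewrite mul0r => /eqP; rewrite subr_eq0 => /eqP.
Qed.

Lemma chargeL_inv_geodesic (d : R) (c : R -> G) l u : 0 < d -> geodesic_on g `]- d, 1 + d[ c ->
  c 0 = 1%g -> 0 <= u <= 1 -> chargeL g (inv \o c) l u = - chargeL g c l u.
Proof.
move=> d0 geo c0 u01; have oI : open `]- d, 1 + d[%classic by exact: itv_open.
have u_I t : 0 <= t <= 1 -> `]- d, 1 + d[%classic t.
  by move=> /andP[t0 t1]; rewrite /= in_itv /=; apply/andP; split; lra.
have dc := geodesic_curve_diff geo (u_I u u01).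
have [_ HL] := (geodesic_chargeL gbi c oI).1 geo.
have [_ HR] := (geodesic_chargeR gbi c oI).1 geo.
have eL : chargeL g c l u = chargeL g c l 0 := const_on_itv d0 (fun t => HL t l) u01.
have eR : chargeR g c l u = chargeR g c l 0 := const_on_itv d0 (fun t => HR t l) u01.
apply: (etrans (chargeL_inv gbi l dc)); apply: (congr1 -%R).
apply: (etrans eR); apply: (etrans _ (esym eL)).
rewrite /chargeL /chargeR /noether_charge c0.
have E : (fun x : G => (x * 1)%g) = (fun x : G => (1 * x)%g).
  by apply/funext => x; rewrite mulg1 mul1g.
exact: (congr1 (fun f : G -> G =>
  inner g 1%g (velocity c 0) (tangent_map f 1%g (delta_mx 0 l))) E).
Qed.

(** Left translation by [p] is an isometry, so the coordinates of [v] in the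
    left-invariant frame are determined by the scalar products of [v] with the frame. *)
Lemma dual_form_inner (B : 'M[R]_n) i (p : G) v : B \in unitmx ->
  dual_form B i p v = ((\row_l inner g p v (tangent_map (fun y : G => (p * y)%g) 1%g (delta_mx 0 l)))
     *m invmx (gram g 1%g) *m invmx B) 0 i.
Proof.
move=> uB; pose T : 'M[R]_n := tangent_mx (fun y : G => (p * y)%g) 1%g.
have dL := mull_diff p 1%g; have isoL := (gbi p).1.
have uT : T \in unitmx by exact: (tangent_mx_unit isoL dL).
have ET : T *m gram g p *m T^T = gram g 1%g.
  by have := isometric_gram isoL dL; rewrite mulg1.
have EF : left_frame B p = B *m T.
  by apply/row_matrixP => j; rewrite rowK row_mul (tangent_mxE _ dL).
have -> : \row_l inner g p v (tangent_map (fun y : G => (p * y)%g) 1%g (delta_mx 0 l)) =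
    v *m gram g p *m T^T.
  apply/rowP => l; rewrite mxE /inner.
  have -> : tangent_map (fun y : G => (p * y)%g) 1%g (delta_mx 0 l) = row l T by rewrite rowK.
  by rewrite !mxE; apply: eq_bigr => k _; rewrite !mxE.
have uG := gram_unit g (1%g : G).
rewrite /dual_form EF; congr (fun_of_matrix _ 0 i).
have uBT : B *m T \in unitmx by rewrite unitmx_mul uB.
set w := (X in _ = X).
(* [w] is checked to be the coordinate vector by multiplying it with the frame. *)
have Ew : w *m (B *m T) = v.
  rewrite /w mulmxA mulmxKV // -(mulmxA v).
  have -> : gram g p *m T^T = invmx T *m gram g 1%g by rewrite -ET !mulmxA mulVmx // mul1mx.
  by rewrite mulmxA mulmxK // mulmxKV.
by rewrite -{1}Ew mulmxK.
Qed.

Lemma dual_form_inv (B : 'M[R]_n) i (d : R) (c : R -> G) u : B \in unitmx -> 0 < d ->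
  geodesic_on g `]- d, 1 + d[ c -> c 0 = 1%g -> 0 <= u <= 1 ->
  dual_form B i ((inv \o c) u) (velocity (inv \o c) u) = - dual_form B i (c u) (velocity c u).
Proof.
move=> uB d0 geo c0 u01.
apply: (etrans (dual_form_inner i _ _ uB)).
apply: (etrans _ (congr1 -%R (esym (dual_form_inner i (c u) (velocity c u) uB)))).
set r := \row_l _; set r' := (X in - ((X *m _ *m _) 0 i)).
have -> : r = - r'.
  by apply/rowP => l; rewrite !mxE; exact: (chargeL_inv_geodesic l d0 geo c0 u01).
by rewrite !mulNmx mxE.
Qed.

End Isometry.

(** * The signature of the inverted geodesic *)

Section SignatureSign.
Context {R : realType} {n : nat} {G : lieGroupType R n}.

(** Only signs are factored out of the integrals, which is legitimate for arbitrary
    integrands. *)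
Lemma simplex_integral_sign (I : Type) (F F' : I -> R -> R) (s : seq I) (a : R) :
  (forall i u, 0 < u < 1 -> F' i u = - F i u) -> 0 <= a ->
  simplex_integral a (map F' s) = (-1) ^+ size s * simplex_integral a (map F s).
Proof.
move=> FF'; elim: s a => [|i s IH] a a0 /=; first by rewrite expr0 mul1r.
pose h u := F i u * simplex_integral u (map F s).
have -> : \int[lebesgue_measure]_(u in `]a, 1[) (F' i u * simplex_integral u (map F' s)) =
    \int[lebesgue_measure]_(u in `]a, 1[) ((-1) ^+ (size s).+1 * h u).
  apply: eq_Rintegral => u; rewrite inE /= in_itv /= => /andP[au u1].
  have u0 : 0 < u by exact: le_lt_trans au.
  by rewrite FF' ?u0 // IH ?(ltW u0) // exprS /h; ring.
rewrite -signr_odd; case: (odd _).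
  rewrite expr1 mulN1r -RintegralN_nonmeasurable; apply: eq_Rintegral => u _.
  by rewrite mulN1r.
by rewrite expr0 mul1r; apply: eq_Rintegral => u _; rewrite mul1r.
Qed.

Lemma signature_sign (B : 'M[R]_n) k (c c' : R -> G) :
  (forall i u, 0 < u < 1 ->
    dual_form B i (c' u) (velocity c' u) = - dual_form B i (c u) (velocity c u)) ->
  signature B k c' = (-1) ^+ k *: signature B k c.
Proof.
move=> H; rewrite /signature scaler_sumr; apply: eq_bigr => I _.
rewrite scalerA; congr (_ *: _).
have := simplex_integral_sign I H (lexx 0).
by rewrite (size_tuple I).
Qed.

(** For a constant path all the forms vanish, hence equal their opposites. *)
Lemma signature_cst (B : 'M[R]_n) k (p : G) : odd k -> signature B k (fun=> p) = 0.
Proof.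
move=> ok; have : signature B k (fun=> p) = - signature B k (fun=> p).
  rewrite {1}(@signature_sign B k (fun=> p) (fun=> p)).
    by rewrite -signr_odd ok expr1 scaleN1r.
  move=> i u _; rewrite /dual_form.
  have -> : velocity (fun=> p) u = 0 :> 'rV[R]_n.
    by rewrite /velocity (_ : _ \o _ = cst (chart_at p p)) // derive1_cst.
  by rewrite mul0mx mxE oppr0.
move=> E; apply/ffunP => J; have := congr1 (fun t : tensor_power R n k => t J) E.
by rewrite !ffunE => /eqP; rewrite -subr_eq0 opprK -mulr2n mulrn_eq0 /= => /eqP.
Qed.

End SignatureSign.

Section GeodesicSignature.
Context {R : realType} {n : nat} {G : lieGroupType R n}.
Variable g : riemannian_metric G.
Hypothesis gbi : bi_invariant g.
Local Notation inv := (fun x : G => x^-1%g).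

(** By uniqueness, the geodesic to [x^-1] is the inverted geodesic to [x].  If there is
    no unique minimizing geodesic to [x], then there is none to [x^-1] either, and both
    sides are signatures of constant paths, hence 0. *)
Lemma signature_geodesic_inv (B : 'M[R]_n) k (x : G) : B \in unitmx -> odd k ->
  signature B k (the_minimizing_geodesic g 1%g x^-1%g) =
  - signature B k (the_minimizing_geodesic g 1%g x).
Proof.
move=> uB ok; rewrite /the_minimizing_geodesic.
case: (xgetP (fun=> 1%g : G) (unique_minimizing_geodesic g 1%g x)) => [c _ uc|no].
  have uc' := unique_minimizing_geodesic_inv gbi uc.
  case: (xgetP (fun=> 1%g : G) (unique_minimizing_geodesic g 1%g x^-1%g)) => [c1 _ uc1|/(_ _ uc')//].
  rewrite (@signature_sign _ _ _ B k c c1); first by rewrite -signr_odd ok expr1 scaleN1r.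
  move=> i u u01; have [[d d0 geo] _ [_ c0 _] _] := uc.1.
  have E : {near u, c1 =1 inv \o c}.
    have := near_itvoo u01; apply: filterS => t /subset_itv_oo_cc t01.
    exact: (uc'.2 c1 uc1.1 t t01).
  rewrite (velocity_near E) (nbhs_singleton E).
  apply: (dual_form_inv gbi i uB d0 geo c0).
  by case/andP: u01 => /ltW -> /ltW ->.
case: (xgetP (fun=> 1%g : G) (unique_minimizing_geodesic g 1%g x^-1%g)) => [c _ uc|_].
  by have := unique_minimizing_geodesic_inv gbi uc; rewrite invgK => /no.
by rewrite signature_cst // oppr0.
Qed.

End GeodesicSignature.

Theorem proposition3p7 (R : realType) (n : nat) (G : lieGroupType R n)
    (g : riemannian_metric G) (mu : {measure set (borel G) -> \bar R})
    (B : 'M[R]_n) (k : nat) :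
  connected [set: G] -> compact [set: G] ->
  bi_invariant g -> haar_measure mu -> B \in unitmx ->
  odd k -> average_signature g mu B k = 0.
Proof.
move=> _ cG gbi hmu uB ok; rewrite /average_signature.
rewrite (_ : finfun _ = 0) ?scaler0 //; apply/ffunP => J; rewrite !ffunE.
apply: (@Rintegral_odd _ (borel G) R mu (fun x : G => x^-1%g) _ _ _ (~` cut_locus g (1%g : G)) _ _ _).
- exact: inv_borel_measurable.
- exact: invgK.
- by move=> A mA; exact: haar_inv.
- by move=> x Cx /(cut_locus_inv gbi); rewrite invgK.
- by move=> x _; rewrite signature_geodesic_inv // ffunE.
Qed.
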